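(* Let $\overline M$ be a Riemannian manifold and let $P=\bigcup_{j=1}^mP_j$ be a finite union of compact embedded submanifolds $P_j\subseteq\overline M$, each of codimension strictly greater than $1$; write $M:=\overline M\setminus P$. Let $E\to\overline M$ be a smooth hermitian vector bundle and let $(D_{\overline M})_0:\Gamma_c^\infty(\overline M,E)\to L^2(\overline M,E)$ be a first-order differential operator. Let $(D_M)_0:\Gamma_c^\infty(M,E|_M)\to L^2(M,E|_M)$ denote the restriction of $(D_{\overline M})_0$ to the smooth compactly supported sections $\Gamma_c^\infty(M,E|_M)$. Then the closure of $(D_M)_0$ coincides with the closure of $(D_{\overline M})_0$, both as operators in $L^2(\overline M,E)$.
   Context: Manifolds are smooth and without boundary; $\overline M$ need not be compact or complete. Differential operators have smooth coefficients. Since $P$ has Riemannian measure zero, $L^2(M,E|_M)$ is identified with $L^2(\overline M,E)$ via extension by zero. $\Gamma^\infty_c$ denotes smooth compactly supported sections. *)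

(* Defs.v *)
From HB Require Import structures.
From mathcomp Require Import all_boot all_order all_algebra.
From mathcomp Require Import all_classical all_reals all_analysis.
From mathcomp Require Import complex.
Set Implicit Arguments.
Unset Strict Implicit.
Unset Printing Implicit Defensive.
Import Order.TTheory GRing.Theory Num.Theory.
Import numFieldNormedType.Exports.
Local Open Scope classical_set_scope.
Local Open Scope ring_scope.

Fixpoint Ck (R : realType) (n k : nat) (U : set 'rV[R]_n)
    (f : 'rV[R]_n -> R) : Prop :=
  if k is k'.+1 then
    (forall x, U x -> differentiable f x) /\ forall v, Ck k' U ('D_v f)
  else forall x, U x -> {for x, continuous f}.

Definition smooth (R : realType) (n : nat) (U : set 'rV[R]_n)
    (f : 'rV[R]_n -> R) : Prop := forall k, Ck k U f.

Definition csmooth (R : realType) (n : nat) (U : set 'rV[R]_n)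
    (f : 'rV[R]_n -> R[i]) : Prop :=
  smooth U (fun x => complex.Re (f x)) /\ smooth U (fun x => complex.Im (f x)).

(* The values of [cfun] outside [cdom], and of [cinv] outside the image of
   [cdom], are irrelevant. *)
Record chart (R : realType) (n : nat) (M : Type) := Chart {
  cdom : set M;
  cfun : M -> 'rV[R]_n;
  cinv : 'rV[R]_n -> M }.

Definition crange (R : realType) (n : nat) (M : Type) (c : chart R n M) :
  set 'rV[R]_n := cfun c @` cdom c.

Definition is_chart (R : realType) (n : nat) (M : topologicalType)
    (c : chart R n M) : Prop :=
  [/\ open (cdom c), open (crange c),
      (forall x, cdom c x -> cinv c (cfun c x) = x),
      (forall x, cdom c x -> {for x, continuous (cfun c)}) &
      (forall y, crange c y -> {for y, continuous (cinv c)})].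

Definition transition (R : realType) (n : nat) (M : Type)
    (c c' : chart R n M) : 'rV[R]_n -> 'rV[R]_n := cfun c' \o cinv c.

Definition compatible (R : realType) (n : nat) (M : Type)
    (c c' : chart R n M) : Prop :=
  forall j : 'I_n, smooth (cfun c @` (cdom c `&` cdom c'))
                          (fun y => transition c c' y ord0 j).

(* Measurable types have a distinguished point, hence so does [carrier]. *)
Record manifold (R : realType) (n : nat) := Manifold {
  carrier :> ptopologicalType;
  atlas : set (chart R n carrier);
  manifold_hausdorff : hausdorff_space carrier;
  manifold_countable : @second_countable carrier;
  atlas_chart : forall c, atlas c -> is_chart c;
  atlas_cover : forall x : carrier, exists2 c, atlas c & cdom c x;
  atlas_compatible : forall c c', atlas c -> atlas c' -> compatible c c';
  atlas_maximal : forall c, is_chart c ->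
    (forall c', atlas c' -> compatible c c' /\ compatible c' c) -> atlas c }.

Definition smooth_on (R : realType) (n : nat) (M : manifold R n) (U : set M)
    (f : M -> R[i]) : Prop :=
  forall c, atlas c -> csmooth (cfun c @` (cdom c `&` U)) (f \o cinv c).

(* [P] is locally a [k]-dimensional coordinate slice. *)
Definition embedded_submanifold (R : realType) (n : nat) (M : manifold R n)
    (k : nat) (P : set M) : Prop :=
  (k <= n)%N /\
  forall p, P p -> exists c, [/\ atlas c, cdom c p &
    forall x, cdom c x ->
      (P x <-> forall i : 'I_n, (k <= i)%N -> cfun c x ord0 i = 0)].

(* The metric is given by its matrices of components in the charts.  Vectors
   are rows, so ['J f x] is the transpose of the usual Jacobian matrix. *)
Record riemannian_metric (R : realType) (n : nat) (M : manifold R n) :=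
  RiemannianMetric {
  gmat : chart R n M -> 'rV[R]_n -> 'M[R]_n;
  gmat_smooth : forall c, atlas c ->
    forall i j, smooth (crange c) (fun y => gmat c y i j);
  gmat_sym : forall c, atlas c ->
    forall y, crange c y -> (gmat c y)^T = gmat c y;
  gmat_pos : forall c, atlas c -> forall y, crange c y ->
    forall v : 'rV[R]_n, v != 0 -> 0 < (v *m gmat c y *m v^T) ord0 ord0;
  gmat_change : forall c c', atlas c -> atlas c' ->
    forall x, cdom c x -> cdom c' x ->
    let J := jacobian (transition c c') (cfun c x) in
    gmat c (cfun c x) = J *m gmat c' (cfun c' x) *m J^T }.

(* Lebesgue integral over R^n of a nonnegative Borel function, as an iterated
   integral (Tonelli). *)
Fixpoint lebesgue_int (R : realType) (n : nat) :
    ('rV[R]_n -> \bar R) -> \bar R :=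
  match n return ('rV[R]_n -> \bar R) -> \bar R with
  | 0%N => fun f => f 0
  | n'.+1 => fun f => (\int[lebesgue_measure]_t
      lebesgue_int (fun v : 'rV[R]_n' =>
        f (row_mx (const_mx t : 'rV[R]_1) v)))%E
  end.

Notation borel T := (g_sigma_algebraType (@open T)).

(* dvol = sqrt(det g) dx in every chart; since the charts cover [M] and [M] is
   second countable, this determines [mu]. *)
Definition is_riemannian_measure (R : realType) (n : nat) (M : manifold R n)
    (g : riemannian_metric M) (mu : {measure set (borel M) -> \bar R}) : Prop :=
  forall c, atlas c -> forall A : set (borel M), measurable A ->
    A `<=` cdom c ->
    mu A = lebesgue_int (fun y =>
      (\1_(cfun c @` A) y * Num.sqrt (\det (gmat g c y)))%:E).

Record trivialization (R : realType) (M : Type) (E : M -> lmodType R[i])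
    (r : nat) := Trivialization {
  tdom : set M;
  tfun : forall x, E x -> 'cV[R[i]]_r;
  tinv : forall x, 'cV[R[i]]_r -> E x }.

(* A complex vector bundle of rank [r] is given by its fibres and by local
   trivializations with smooth transition matrices; this determines the
   topology and the smooth structure of the total space. *)
Record hermitian_bundle (R : realType) (n : nat) (M : manifold R n) (r : nat) :=
  HermitianBundle {
  fiber :> M -> lmodType R[i];
  trivs : set (trivialization fiber r);
  triv_open : forall t, trivs t -> open (tdom t);
  triv_cover : forall x : M, exists2 t, trivs t & tdom t x;
  triv_iso : forall t, trivs t -> forall x, tdom t x ->
    [/\ linear (@tfun _ _ _ _ t x),
        cancel (@tfun _ _ _ _ t x) (tinv t x) &
        cancel (tinv t x) (@tfun _ _ _ _ t x)];
  triv_transition : forall t t', trivs t -> trivs t' -> forall i j,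
    smooth_on (tdom t `&` tdom t')
      (fun x => tfun t' (tinv t x (delta_mx j ord0)) i ord0);
  herm : forall x, fiber x -> fiber x -> R[i];
  herm_linear : forall x (w : fiber x) (a : R[i]) (u v : fiber x),
    herm (a *: u + v) w = a * herm u w + herm v w;
  herm_conj : forall x (u v : fiber x), herm u v = (herm v u)^*%C;
  herm_pos : forall x (u : fiber x), u != 0 -> 0 < herm u u;
  herm_smooth : forall t, trivs t -> forall i j,
    smooth_on (tdom t) (fun x =>
      herm (tinv t x (delta_mx i ord0)) (tinv t x (delta_mx j ord0))) }.

Section Sections.
Context {R : realType} {n : nat} {M : manifold R n} {r : nat}.
Variable E : hermitian_bundle M r.

Definition section : Type := forall x : M, E x.

Definition smooth_section (u : section) : Prop :=
  forall t, trivs t -> forall i, smooth_on (tdom t)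
    (fun x => tfun t (u x) i ord0).

Definition section_support (u : section) : set M :=
  closure [set x | u x != 0].

(* For an open subset [W], smooth compactly supported sections of [E|_W],
   extended by zero. *)
Definition Gamma_c (W : set M) : set section :=
  [set u | [/\ smooth_section u, compact (section_support u) &
               section_support u `<=` W]].

Definition cderive (v : 'rV[R]_n) (f : 'rV[R]_n -> 'cV[R[i]]_r)
    (y : 'rV[R]_n) : 'cV[R[i]]_r :=
  \col_i Complex ('D_v (fun z => complex.Re (f z i ord0)) y)
                 ('D_v (fun z => complex.Im (f z i ord0)) y).

(* [D] matters only on [Gamma_c setT]; there
   D u = \sum_i a_i (d_i u) + b u in every chart and trivialization. *)
Definition first_order_operator (D : section -> section) : Prop :=
  forall c t, atlas c -> trivs t ->
  let W := cdom c `&` tdom t in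
  exists (a : 'I_n -> 'rV[R]_n -> 'M[R[i]]_r) (b : 'rV[R]_n -> 'M[R[i]]_r),
  [/\ (forall i k l, csmooth (cfun c @` W) (fun y => a i y k l)),
      (forall k l, csmooth (cfun c @` W) (fun y => b y k l)) &
      forall u, Gamma_c setT u -> forall x, W x ->
        let y := cfun c x in
        tfun t (D u x) =
          \sum_(i < n) a i y *m cderive (delta_mx ord0 i)
                         (fun z => tfun t (u (cinv c z))) y
          + b y *m tfun t (u x)].

Variable mu : {measure set (borel M) -> \bar R}.

Definition measurable_section (u : section) : Prop :=
  forall t, trivs t -> forall i,
    measurable_fun (tdom t : set (borel M))
      (fun x : borel M => complex.Re (tfun t (u x) i ord0)) /\
    measurable_fun (tdom t : set (borel M))
      (fun x : borel M => complex.Im (tfun t (u x) i ord0)).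

Definition L2normsq (u : section) : \bar R :=
  (\int[mu]_(x in [set: borel M]) (complex.Re (herm (u x) (u x)))%:E)%E.

Definition L2 : set section :=
  [set u | measurable_section u /\ (L2normsq u < +oo)%E].

Definition L2distsq (u v : section) : \bar R := L2normsq (fun x => u x - v x).

(* Elements of L^2 are handled through representatives, and operators in L^2
   through their graphs.  [op_closure G] is invariant under almost everywhere
   equality, hence is the set of representatives of the closure of [G] in
   L^2 x L^2. *)
Definition op_closure (G : set (section * section)) : set (section * section) :=
  [set p | [/\ L2 p.1, L2 p.2 &
    forall e : R, 0 < e -> exists q, [/\ G q,
      (L2distsq q.1 p.1 < e%:E)%E & (L2distsq q.2 p.2 < e%:E)%E]]].

Definition op_graph (D : section -> section) (dom : set section) :
  set (section * section) := [set (u, D u) | u in dom].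

End Sections.

Arguments Gamma_c {R n M r} E W.

(* Main.v *)
Require Import Defs.
From HB Require Import structures.
From mathcomp Require Import all_boot all_order all_algebra.
From mathcomp Require Import all_classical all_reals all_analysis.
From mathcomp Require Import measurable_realfun simple_functions.
From mathcomp Require Import complex.
From mathcomp Require finmap.
From mathcomp Require Import ring lra.
Set Implicit Arguments.
Unset Strict Implicit.
Unset Printing Implicit Defensive.
Import Order.TTheory GRing.Theory Num.Theory.
Import numFieldNormedType.Exports.
Local Open Scope classical_set_scope.
Local Open Scope ring_scope.

(** Given [u] in the larger domain, one multiplies it by cutoffs [f_N] that vanish
    near a piece [K] of the submanifold, and removes finitely many such pieces one
    after the other.  In a slice chart, [1 - f_N] is the mean of [N] bumps, the
    [j]-th of which has width [2^-j] in the last two coordinates.  The gradient of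
    the [j]-th bump is [O(2^j)] on a box of measure [O(4^-j)].  Since the partial
    sums of the geometric series [2^j] are dominated by their last term,
    [|grad f_N|^2] is at most a constant times [N^-2] times the sum of the [4^j]
    over the boxes containing the point, so that its integral is [O(1/N)]; hence
    [f_N u] tends to [u] and [D (f_N u)] to [D u].  No measurability of [D u] is
    available, but none is needed: the integral of a nonnegative function is a
    lower integral, for which the triangle inequality still holds when one of the
    summands is measurable. *)

(** * Integrals of nonmeasurable functions *)

Import HBNNSimple.

Section LowerIntegral.
Context d (T : measurableType d) (R : realType) (mu : {measure set T -> \bar R}).
Implicit Types f g F : T -> \bar R.
Local Open Scope ereal_scope.

(** Both sides are suprema over the simple functions lying below the integrand, and this family
    grows with the integrand, measurable or not. *)
Lemma integral_mono f g : (forall x, 0 <= f x) -> (forall x, f x <= g x) ->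
  \int[mu]_(x in [set: T]) f x <= \int[mu]_(x in [set: T]) g x.
Proof.
move=> f0 fg.
rewrite !ge0_integralTE//; last by move=> x; exact: le_trans (fg x).
apply: ereal_sup_le => _ [h hf <-]; exists h => //= x.
exact: le_trans (hf x) (fg x).
Qed.

(** For a simple [h <= f], the positive part of [h - F] is measurable and lies below [a g]; since
    [h] is at most [F] plus this part, additivity is only used between measurable functions. *)
Lemma integral_le_addl f F g (a : R) : (0 < a)%R ->
  (forall x, 0 <= f x) -> measurable_fun [set: T] F -> (forall x, 0 <= F x) ->
  (forall x, F x < +oo) -> (forall x, 0 <= g x) ->
  (forall x, f x <= F x + a%:E * g x) ->
  \int[mu]_(x in [set: T]) f x <=
  \int[mu]_(x in [set: T]) F x + a%:E * \int[mu]_(x in [set: T]) g x.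
Proof.
move=> a0 f0 mF F0 Fy g0 fFg.
rewrite (ge0_integralTE _ f0).
apply: ge_ereal_sup => _ [h hf <-].
pose H x := maxe 0 ((h x)%:E - F x).
have mh : measurable_fun [set: T] (fun x => (h x)%:E) by apply/measurable_EFinP.
have mH : measurable_fun [set: T] H.
  by apply: measurable_maxe => //; exact: emeasurable_funB.
have H0 x : 0 <= H x by rewrite /H le_max lexx.
have mHa : measurable_fun [set: T] (fun x => (a^-1)%:E * H x).
  by apply: measurable_funeM.
have -> : sintegral mu h = \int[mu]_(x in [set: T]) (h x)%:E.
  by rewrite integral_nnsfun// patch_setT.
apply: (@le_trans _ _ (\int[mu]_(x in [set: T]) (F x + H x))).
  apply: integral_mono => x; first by rewrite lee_fin.
  have := F0 x; have := Fy x; rewrite /H; case: (F x) => [r| |]//= _ _.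
  rewrite -EFinB; have [h1|h1] := leP 0 (h x - r)%:E.
    by rewrite -EFinD lee_fin; lra.
  by rewrite adde0 lee_fin; move: h1; rewrite lte_fin; lra.
rewrite ge0_integralD//; apply: leeD => //.
(* The factor [a] is pulled out of the measurable [H]; then [g] enters through monotonicity
   alone. *)
have -> : \int[mu]_(x in [set: T]) H x =
    a%:E * \int[mu]_(x in [set: T]) ((a^-1)%:E * H x).
  rewrite ge0_integralZl//; last by rewrite lee_fin invr_ge0 ltW.
  by rewrite muleA -EFinM divff ?gt_eqF// mul1e.
apply: lee_wpmul2l; first by rewrite lee_fin ltW.
apply: integral_mono => x; first by rewrite mule_ge0// lee_fin invr_ge0 ltW.
have := hf x; have := fFg x; have := F0 x; have := Fy x; have := g0 x.
rewrite /H; case: (F x) => [r| |]//= gx _ _ ff hff.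
have := le_trans hff ff; move: gx; case: (g x) => [s| |]//= s0.
- rewrite -EFinM -EFinD lee_fin => hr.
  have [h1|h1] := leP 0 ((h x)%:E - r%:E).
    rewrite -EFinB -EFinM lee_fin mulrC ler_pdivrMr//; lra.
  by rewrite mule0.
- by rewrite leey.
Qed.

End LowerIntegral.

(** * Iterated Lebesgue integrals over boxes *)

Section LebesgueInt.
Variable R : realType.
Local Open Scope ereal_scope.

Lemma lebesgue_int_ge0 n (f : 'rV[R]_n -> \bar R) :
  (forall y, 0 <= f y) -> 0 <= lebesgue_int f.
Proof.
elim: n f => [|n IH] f f0 /=; first exact: f0.
by apply: integral_ge0 => t _; exact: IH.
Qed.

(** Induction on the dimension: the inner integral is at most a constant when the first coordinate
    lies in its interval, and is zero otherwise. *)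
Lemma lebesgue_int_box n (p : 'rV[R]_n) (w : 'I_n -> R) (G : R)
    (f : 'rV[R]_n -> \bar R) :
  (forall i, 0 <= w i)%R -> (0 <= G)%R -> (forall y, 0 <= f y) ->
  (forall y, f y <= G%:E) ->
  (forall y : 'rV[R]_n, ~ (forall i, `|y ord0 i - p ord0 i| <= w i)%R -> f y = 0) ->
  lebesgue_int f <= (G * \prod_i (2 * w i))%:E.
Proof.
elim: n p w G f => [|n IH] p w G f w0 G0 f0 fG fbox /=.
  by rewrite big_ord0 mulr1.
pose p' : 'rV[R]_n := \row_i p ord0 (lift ord0 i).
pose w' := fun i : 'I_n => w (lift ord0 i).
pose C : R := (G * \prod_i (2 * w' i))%R.
have C0 : (0 <= C)%R.
  by apply: mulr_ge0 => //; apply: prodr_ge0 => i _; apply: mulr_ge0 => //; exact: w0.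
set I : set R := `[(p ord0 ord0 - w ord0)%R, (p ord0 ord0 + w ord0)%R]%classic.
have mI : measurable (I : set (measurableTypeR R)) by exact: measurable_itv.
have H t (v : 'rV[R]_n) :
    (forall i, `|row_mx (const_mx t : 'rV[R]_1) v ord0 i - p ord0 i| <= w i)%R ->
    I t /\ forall i, (`|v ord0 i - p' ord0 i| <= w' i)%R.
  move=> h; split.
    have := h ord0; rewrite mxE; case: splitP => //= j _.
    rewrite mxE ler_norml => /andP[? ?].
    rewrite /I /= in_itv /=; apply/andP; split; lra.
  move=> i; have := h (lift ord0 i); rewrite mxE /p' /w' [in X in _ -> X]mxE.
  case: splitP => [[[|//] hj]//= | k /= hk].
  by have -> : k = i by apply/val_inj; move: hk; rewrite /= /bump /= !add1n => -[].
apply: (@le_trans _ _ (\int[lebesgue_measure]_(t in [set: R]) (C * \1_I t)%:E)).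
  apply: integral_mono => t; first by apply: lebesgue_int_ge0 => v; exact: f0.
  have [It|nIt] := pselect (I t).
    rewrite indicE mem_set// mulr1.
    apply: (IH p') => //.
      by move=> i; exact: w0.
    by move=> v hv; apply: fbox => h; apply: hv; exact: (H t v h).2.
  rewrite indicE memNset// mulr0.
  (* Off the interval the slice of [f] vanishes identically, so the induction hypothesis applies
     with the bound [0]. *)
  have := IH p' w' 0%R (fun v => f (row_mx (const_mx t : 'rV[R]_1) v)).
  rewrite mul0r; apply => //.
  - by move=> i; exact: w0.
  - move=> v; rewrite fbox// => h; exact: nIt (H t v h).1.
  - move=> v _; apply: fbox => h; exact: nIt (H t v h).1.
under eq_integral do rewrite EFinM.
rewrite ge0_integralZl//; last first.
  by apply/measurable_EFinP; exact: measurable_indic.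
rewrite integral_indic// setIT.
rewrite [X in (_ * X)%E](lebesgue_measure_itv
  `[(p ord0 ord0 - w ord0)%R, (p ord0 ord0 + w ord0)%R])/= lte_fin.
have -> : (G * \prod_i (2 * w i) = C * (2 * w ord0))%R.
  by rewrite big_ord_recl mulrCA mulrC.
rewrite [leRHS]EFinM.
apply: lee_wpmul2l; first by rewrite lee_fin.
case: ifPn => _; last by rewrite lee_fin mulr_ge0.
by rewrite -EFinB lee_fin; lra.
Qed.

End LebesgueInt.

(** * Calculus of [Ck] functions *)

(** The difference [g - f] vanishes near [x], so it has an expansion with zero linear part and is
    differentiable; then [g = f + (g - f)]. *)
Lemma near_eq_differentiable (R : realType) (V W : normedModType R)
    (f g : V -> W) (x : V) :
  (\near x, f x = g x) -> differentiable f x -> differentiable g x.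
Proof.
move=> fg df.
suff dk : differentiable (g - f) x.
  by have -> : g = f + (g - f); [rewrite addrC subrK|exact: differentiableD].
have E : (g - f) \o shift x = cst ((g - f) x) + (\0 : V -> W) +o_ 0 id.
  apply/eqaddoP => e e0; near=> h => /=.
  rewrite !fctE /= (nbhs_singleton fg) subrr addr0 oppr0 addr0.
  have -> : f (h + x) = g (h + x).
    by near: h; move: fg; rewrite (near_shift 0) /= subr0.
  by rewrite subrr normr0 mulr_ge0 // ltW.
have c0 : continuous (\0 : V -> W) by move=> y; exact: cvg_cst.
have D : 'd (g - f) x = \0 :> (V -> W) by apply: (@diff_unique _ _ _ _ \0).
by apply/diff_locallyP; rewrite D.
Unshelve. all: by end_near. Qed.

Section CkCalculus.
Variables (R : realType) (n : nat).
Notation V := 'rV[R]_n.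
Implicit Types (U W : set V) (f g : V -> R).

(** Since [U] is open, the equality holds near each of its points and so passes to directional
    derivatives. *)
Lemma Ck_ext k U f g : open U -> (forall x, U x -> f x = g x) ->
  Ck k U f -> Ck k U g.
Proof.
move=> oU; elim: k f g => [|k IH] f g fg /=.
  move=> cf x Ux; have nfg : \near x, f x = g x.
    by apply: filterS (open_nbhs_nbhs (conj oU Ux)); exact: fg.
  suff : g y @[y --> x] --> f x by rewrite (fg _ Ux).
  apply: cvg_trans (cf x Ux).
  exact: (@near_eq_cvg _ _ (nbhs x) _ f g nfg).
move=> [df Df]; split=> [x Ux|v].
  apply: near_eq_differentiable (df x Ux).
  by apply: filterS (open_nbhs_nbhs (conj oU Ux)); exact: fg.
apply: IH (Df v) => x Ux; apply: near_eq_derive.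
by apply: filterS (open_nbhs_nbhs (conj oU Ux)); exact: fg.
Qed.

Lemma Ck_subset k U W f : U `<=` W -> Ck k W f -> Ck k U f.
Proof.
move=> UW; elim: k f => [|k IH] f /= => [cf x Ux|[df Df]].
  by apply: cf; exact: UW.
by split=> [x Ux|v]; [apply: df; exact: UW|exact: IH].
Qed.

(** [Ck] on a set only speaks of [f] and its full derivatives at the points of the set, so it can be
    checked point by point. *)
Lemma Ck_local k U f :
  (forall x, U x -> exists2 W, W x & Ck k W f) -> Ck k U f.
Proof.
elim: k f => [|k IH] f /= H.
  by move=> x Ux; have [W Wx] := H x Ux; apply.
split=> [x Ux|v]; first by have [W Wx [+ _]] := H x Ux; apply.
by apply: IH => x Ux; have [W Wx [_ D]] := H x Ux; exists W.
Qed.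

Lemma CkW k U f : Ck k.+1 U f -> Ck k U f.
Proof.
elim: k f => [|k IH] f [df Df].
  by move=> x Ux; apply: differentiable_continuous; exact: df.
by split=> // v; apply: IH; exact: Df.
Qed.

Lemma Ck_cst k U (a : R) : Ck k U (fun=> a).
Proof.
elim: k a => [|k IH] a /=; first by move=> x _; exact: (@cst_continuous V R).
split=> [x _|v]; first exact: differentiable_cst.
have -> : 'D_v (fun _ : V => a) = (fun=> 0).
  by apply/funext => x; exact: derive_cst.
exact: IH.
Qed.

Lemma Ck_add k U f g : open U -> Ck k U f -> Ck k U g ->
  Ck k U (fun x => f x + g x).
Proof.
move=> oU; elim: k f g => [|k IH] f g /=.
  by move=> cf cg x Ux; exact: (continuousD (cf x Ux) (cg x Ux)).
move=> [df Df] [dg Dg]; split=> [x Ux|v].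
  by apply: differentiableD; [exact: df|exact: dg].
apply: Ck_ext (IH _ _ (Df v) (Dg v)) => // x Ux.
by rewrite (@deriveD _ _ _ f g)//; apply: diff_derivable; [exact: df|exact: dg].
Qed.

Lemma Ck_mul k U f g : open U -> Ck k U f -> Ck k U g ->
  Ck k U (fun x => f x * g x).
Proof.
move=> oU; elim: k f g => [|k IH] f g.
  by move=> cf cg x Ux; exact: (continuousM (cf x Ux) (cg x Ux)).
move=> cf cg; have [df Df] := cf; have [dg Dg] := cg; split=> [x Ux|v].
  by apply: differentiableM; [exact: df|exact: dg].
have := Ck_add oU (IH _ _ (CkW cf) (Dg v)) (IH _ _ (CkW cg) (Df v)).
apply: Ck_ext => // x Ux.
by rewrite (@deriveM _ _ f g)//; apply: diff_derivable; [exact: df|exact: dg].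
Qed.

Lemma Ck_sum k U (I : Type) (s : seq I) (f : I -> V -> R) : open U ->
  (forall i, Ck k U (f i)) -> Ck k U (fun x => \sum_(i <- s) f i x).
Proof.
move=> oU fs; elim: s => [|i s IH].
  by under eq_fun do rewrite big_nil; exact: Ck_cst.
by under eq_fun do rewrite big_cons; exact: Ck_add.
Qed.

Lemma Ck_prod k U (I : Type) (s : seq I) (f : I -> V -> R) : open U ->
  (forall i, Ck k U (f i)) -> Ck k U (fun x => \prod_(i <- s) f i x).
Proof.
move=> oU fs; elim: s => [|i s IH].
  by under eq_fun do rewrite big_nil; exact: Ck_cst.
by under eq_fun do rewrite big_cons; exact: Ck_mul.
Qed.

Lemma derive_coord (i : 'I_n) (v x : V) : 'D_v (fun y : V => y ord0 i) x = v ord0 i.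
Proof.
rewrite deriveE; last exact: differentiable_coord.
pose c := fun y : V => y ord0 i : R.
have lin_c : linear c by move=> a y z; rewrite /c !mxE.
pose cM := GRing.isLinear.Build _ _ _ _ _ lin_c.
(* The coordinate is packed as a continuous linear map, which is its own differential. *)
pose cL : {linear V -> R} := HB.pack c cM.
have -> : (fun y : V => y ord0 i) = cL by [].
rewrite diff_lin//; exact: coord_continuous.
Qed.

Lemma Ck_coord k U (i : 'I_n) : Ck k U (fun y : V => y ord0 i).
Proof.
case: k => [|k]; first by move=> x _; exact: coord_continuous.
split=> [x _|v]; first exact: differentiable_coord.
by have -> : 'D_v (fun y : V => y ord0 i) = fun=> v ord0 i;
  [apply/funext => x; exact: derive_coord|exact: Ck_cst].
Qed.

Lemma derive_comp (f : V -> R) (h : R -> R) (x v : V) :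
  differentiable f x -> derivable h (f x) 1 ->
  'D_v (h \o f) x = 'D_1 h (f x) * 'D_v f x.
Proof.
move=> df /derivable1_diffP dh.
rewrite (deriveE v (differentiable_comp df dh)) (deriveE v df) (deriveE (1 : R) dh).
rewrite (diff_comp df dh) /=; set t := 'd f x v.
by have /= := linearZZ ('d h (f x)) t 1; rewrite /GRing.scale/= mulr1 mulrC.
Qed.

End CkCalculus.

(** * A smooth cutoff function *)

Section Bump.
Variable R : realType.

(* All powers [m] are included to have a family closed under derivation. *)
Definition flat (m : nat) (x : R) : R :=
  if 0 < x then x^-1 ^+ m * expR (- x^-1) else 0.

Lemma flat_ge0 m x : 0 <= flat m x.
Proof.
rewrite /flat; case: ifPn => // x0.
by rewrite mulr_ge0 ?expR_ge0// exprn_ge0// invr_ge0 ltW.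
Qed.

Lemma flat_le0 m x : x <= 0 -> flat m x = 0.
Proof. by rewrite /flat leNgt => /negbTE ->. Qed.

(** With [t = 1/x] this says [t^m / m! <= exp t]: one term of the exponential series. *)
Lemma flat_le_fact m x : flat m x <= m`!%:R.
Proof.
rewrite /flat; case: ifPn => // x0.
have t0 : 0 < x^-1 by rewrite invr_gt0.
case: m => [|m].
  by rewrite expr0 mul1r fact0 -expR0 ler_expR oppr_le0 ltW.
rewrite expRN ler_pdivrMr ?expR_gt0//.
rewrite mulrC -ler_pdivrMr ?ltr0n ?fact_gt0//.
by apply: le_trans (expR_ge1Dxn m (ltW t0)); rewrite lerDr.
Qed.

(** Trades two powers of [1/x] for a factor [x^2], to control the difference quotient at [0]. *)
Lemma flat_lower m x : flat m x = x ^+ 2 * flat m.+2 x.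
Proof.
rewrite /flat; case: ifPn => x0; last by rewrite mulr0.
rewrite mulrA -(addn2 m) exprD mulrCA -exprMn divff ?gt_eqF//.
by rewrite expr1n mulr1.
Qed.

(** Away from [0] this is the product rule. At [0] the difference quotient is [h * flat m.+2 h] by
    [flat_lower], and [flat m.+2] is bounded. *)
Lemma is_derive_flat m x :
  is_derive x (1 : R) (flat m) (flat m.+2 x - m%:R * flat m.+1 x).
Proof.
have [x0|x0|->] := ltgtP x 0.
- rewrite !flat_le0 ?ltW// mulr0 subr0.
  apply: (near_eq_is_derive (f := cst 0)).
  near=> y; rewrite flat_le0// ltW//; near: y; exact: lt_nbhsl.
- rewrite {2 3}/flat x0.
  pose h (y : R) := y^-1 ^+ m * expR (- y^-1).
  apply: (near_eq_is_derive (f := h)).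
    near=> y; rewrite /flat ifT//; near: y; exact: lt_nbhsr.
  have xn0 : x != 0 by rewrite gt_eqF.
  have dV : is_derive x 1 (fun y : R => y^-1) (- x ^- 2).
    have := is_deriveV xn0 (is_derive_id x (1 : R)).
    by rewrite /GRing.scale /= mulr1.
  have dE : is_derive x 1 (expR \o (fun y : R => - y^-1))
      (expR (- x^-1) * x ^- 2).
    have := @is_derive1_comp _ expR (fun y : R => - y^-1) x _ _
      (is_derive_expR _) (is_deriveN dV).
    by rewrite opprK.
  have D := is_deriveM (is_deriveX m dV) dE.
  rewrite (_ : h = (fun y : R => y^-1) ^+ m * (expR \o (fun y : R => - y^-1))).
    apply: (is_derive_eq D); rewrite /= /GRing.scale /= !fctE -exprVn.
    case: m {h D} => [|m] /=; first by rewrite !mul0r mulr0 addr0 subr0; ring.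
    by rewrite !exprS; ring.
  by apply/funext => y; rewrite /h !fctE.
rewrite !flat_le0// mulr0 subr0.
suff H : h^-1 *: ((flat m \o shift 0) (h *: 1) - flat m 0) @[h --> 0^'] --> (0 : R).
  by apply: DeriveDef; [apply/cvg_ex; exists 0|exact: cvg_lim].
apply/cvgrPdist_le => e e0; near=> h.
rewrite /= addr0 (flat_le0 _ (lexx 0)) subr0 sub0r normrN [_ *: 1]mulr1.
have h0 : h != 0 by near: h; exact: nbhs_dnbhs_neq.
rewrite /GRing.scale /= flat_lower expr2 -mulrA mulKf// normrM.
rewrite (ger0_norm (flat_ge0 _ _)).
apply: (@le_trans _ _ (`|h| * m.+2`!%:R)).
  by rewrite ler_wpM2l// flat_le_fact.
rewrite -ler_pdivlMr ?ltr0n ?fact_gt0//.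
near: h; apply: dnbhs0_le; by rewrite divr_gt0// ltr0n fact_gt0.
Unshelve. all: by end_near. Qed.

(** Induction on the order for all [m] at once, because the derivative involves the indices [m + 1]
    and [m + 2]. *)
Lemma Ck_flat n k (U : set 'rV[R]_n) f m : open U -> Ck k U f ->
  Ck k U (fun y => flat m (f y)).
Proof.
move=> oU; elim: k m f => [|k IH] m f cf.
  move=> x Ux; apply: (@continuous_comp _ _ _ f (flat m)); first exact: cf.
  apply: differentiable_continuous; apply/derivable1_diffP.
  by have [] := is_derive_flat m (f x).
have [df Df] := cf; split=> [x Ux|v].
  apply: (@differentiable_comp _ _ _ _ f (flat m)); first exact: df.
  by apply/derivable1_diffP; have [] := is_derive_flat m (f x).
have cf' := CkW cf.
apply: (@Ck_ext _ _ _ _ (fun y =>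
   (flat m.+2 (f y) + (- m%:R) * flat m.+1 (f y)) * 'D_v f y)) => //.
  move=> x Ux; have Dh := is_derive_flat m (f x).
  have -> : (fun y => flat m (f y)) = flat m \o f by [].
  rewrite derive_comp//; last exact: df.
  by rewrite derive_val mulNr.
apply: (Ck_mul oU _ (Df v)); apply: (Ck_add oU (IH _ _ cf')).
exact: (Ck_mul oU (Ck_cst _ _ _) (IH _ _ cf')).
Qed.

Let e1 := flat 0 1.

Let e1_gt0 : 0 < e1.
Proof. by rewrite /e1 /flat ltr01 mulr_gt0// expR_gt0. Qed.

Let q := flat 0 e1.

Let q_gt0 : 0 < q.
Proof. by rewrite /q /flat e1_gt0 mulr_gt0// expR_gt0. Qed.

(** The affine map taking [[1/4, 1]] onto [[0, 1]]. *)
Let ramp (s : R) := 4 / 3 * s - 3^-1.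

(** A smooth step from two nested copies of [flat 0]: for [s <= 1/4] the inner one is [0] and the
    outer one is [q]; for [s >= 1] the inner one is at least [e1] and the outer one is [0]. *)
Definition cutoff (s : R) : R := q^-1 * flat 0 (e1 - flat 0 (ramp s)).

Definition dcutoff (s : R) : R :=
  q^-1 * (- (flat 2 (e1 - flat 0 (ramp s)) * (flat 2 (ramp s) * (4 / 3)))).

(** One constant for both [cutoff] and its derivative: each [2] is the bound [2!] of [flat 2], and
    [4 / 3] is the slope of [ramp]. *)
Definition cutoff_bound : R := q^-1 * (2 * (2 * (4 / 3))).

Lemma cutoff_bound_ge0 : 0 <= cutoff_bound.
Proof. by rewrite /cutoff_bound mulr_ge0 ?invr_ge0 ?ltW//; lra. Qed.

Lemma cutoff_eq1 s : s <= 4^-1 -> cutoff s = 1.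
Proof.
move=> hs; rewrite /cutoff (@flat_le0 _ (ramp s)); last by rewrite /ramp; lra.
by rewrite subr0 mulVf// gt_eqF.
Qed.

Let flat_ramp s : 1 <= s -> e1 - flat 0 (ramp s) <= 0.
Proof.
move=> s1; have r1 : 1 <= ramp s by rewrite /ramp; lra.
rewrite subr_le0 /e1 /flat ltr01 ifT; last by rewrite (lt_le_trans ltr01).
rewrite !expr0 !mul1r ler_expR lerN2 invr1 invf_le1//.
by rewrite (lt_le_trans ltr01).
Qed.

Lemma cutoff_eq0 s : 1 <= s -> cutoff s = 0.
Proof. by move=> s1; rewrite /cutoff flat_le0 ?mulr0// flat_ramp. Qed.

Lemma dcutoff_eq0 s : 1 <= s -> dcutoff s = 0.
Proof.
by move=> s1; rewrite /dcutoff [flat 2 (e1 - _)]flat_le0 ?mul0r ?oppr0 ?mulr0// flat_ramp.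
Qed.

Lemma cutoff_le s : `|cutoff s| <= cutoff_bound.
Proof.
rewrite /cutoff /cutoff_bound normrM gtr0_norm ?invr_gt0//.
rewrite ler_pM2l ?invr_gt0// ger0_norm ?flat_ge0//.
by apply: (le_trans (flat_le_fact _ _)); rewrite fact0; lra.
Qed.

Lemma dcutoff_le s : `|dcutoff s| <= cutoff_bound.
Proof.
rewrite /dcutoff /cutoff_bound normrM gtr0_norm ?invr_gt0//.
rewrite ler_pM2l ?invr_gt0// normrN normrM (normrM (flat 2 (ramp s))).
rewrite (@ger0_norm _ (4 / 3)); last by lra.
rewrite (ger0_norm (flat_ge0 2 (ramp s))) ger0_norm ?flat_ge0//.
have h2 x : flat 2 x <= 2 := flat_le_fact 2 x.
rewrite ler_pM ?mulr_ge0 ?flat_ge0//; try lra.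
by rewrite ler_wpM2r//; lra.
Qed.

Lemma is_derive_cutoff s : is_derive s (1 : R) cutoff (dcutoff s).
Proof.
have d0 x : is_derive x (1 : R) (flat 0) (flat 2 x).
  by apply: is_derive_eq (is_derive_flat 0 x) _; rewrite mul0r subr0.
have dr : is_derive s (1 : R) ramp (4 / 3).
  have := is_deriveB (is_deriveZ (4 / 3) (is_derive_id s (1 : R)))
    (is_derive_cst (3^-1 : R) s (1 : R)).
  by rewrite subr0 /GRing.scale /= mulr1.
have d1 := @is_derive1_comp _ (flat 0) ramp s _ _ (d0 _) dr.
have d2 := is_deriveB (is_derive_cst e1 s (1 : R)) d1.
have d3 := @is_derive1_comp _ (flat 0) _ s _ _ (d0 _) d2.
have := is_deriveZ q^-1 d3.
by rewrite sub0r mulrN.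
Qed.

Lemma Ck_cutoff n k (U : set 'rV[R]_n) f : open U -> Ck k U f ->
  Ck k U (fun y => cutoff (f y)).
Proof.
move=> oU cf; rewrite /cutoff; apply: (Ck_mul oU (Ck_cst _ _ _)).
apply: (Ck_flat 0 oU).
have -> : (fun y => e1 - flat 0 (ramp (f y))) =
    (fun y => e1 + (- 1) * flat 0 (4 / 3 * f y + - 3^-1)).
  by apply/funext => y; rewrite mulN1r.
apply: (Ck_add oU (Ck_cst _ _ _)); apply: (Ck_mul oU (Ck_cst _ _ _)).
apply: (Ck_flat 0 oU); apply: (Ck_add oU _ (Ck_cst _ _ _)).
exact: (Ck_mul oU (Ck_cst _ _ _)).
Qed.

End Bump.

(** * The logarithmic cutoff in coordinates *)

Lemma prod_last2 (R : realType) n (t : R) : (1 < n)%N ->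
  \prod_(i < n) (if (n - 2 <= i)%N then t else 1) = t * t.
Proof.
case: n => [|[|n]]// _; rewrite subn2 /= !big_ord_recr /= leqnn leqnSn.
by rewrite big1 ?mul1r// => i _; rewrite leqNgt ltn_ord.
Qed.

Section LogCutoff.
Variables (R : realType) (n : nat) (p : 'rV[R]_n) (L : R).
Hypothesis L_gt0 : 0 < L.
Notation V := 'rV[R]_n.

(* Only the last two coordinates are rescaled: the slice chart is chosen such
   that they vanish on the submanifold. *)
Definition scale (j : nat) (i : 'I_n) : R :=
  if (n - 2 <= i)%N then L * 2 ^+ j else L.

(** The squared Euclidean norm of the rescaled [y - p]; unlike a maximum of coordinates it is
    smooth. The [j]-th bump is [cutoff (quad j y)]. *)
Definition quad (j : nat) (y : V) : R :=
  \sum_i (scale j i * (y ord0 i - p ord0 i)) ^+ 2.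

Definition box (j : nat) : set V :=
  [set y | forall i, `|y ord0 i - p ord0 i| <= (scale j i)^-1].

Definition logcut (N : nat) (y : V) : R :=
  1 - N%:R^-1 * \sum_(j < N) cutoff (quad j y).

(* Controls [1 - logcut N] and the partial derivatives of [logcut N]. *)
Definition overlap (N : nat) (y : V) : R :=
  N%:R^-1 * \sum_(j < N) 2 ^+ j * \1_(box j) y.

(** The summand [1] serves the values of the bumps; [2 * L] serves their gradients, where the
    derivative of [quad j] is at most [2 * L * 2 ^+ j] on the box. *)
Definition logcut_bound : R := cutoff_bound R * (1 + 2 * L).

Lemma logcut_bound_ge0 : 0 <= logcut_bound.
Proof. by rewrite mulr_ge0 ?cutoff_bound_ge0//; have := L_gt0; lra. Qed.

Lemma scale_gt0 j i : 0 < scale j i.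
Proof. by rewrite /scale; case: ifP => _ //; rewrite mulr_gt0// exprn_gt0. Qed.

Lemma scale_le j i : scale j i <= L * 2 ^+ j.
Proof.
rewrite /scale; case: ifP => _ //.
by rewrite ler_peMr ?exprn_ege1 ?ler1n// ltW.
Qed.

Lemma scale_ge j i : L <= scale j i.
Proof.
rewrite /scale; case: ifP => _ //.
by rewrite ler_peMr ?exprn_ege1 ?ler1n// ltW.
Qed.

Lemma box_subset j : box j `<=` box 0.
Proof.
move=> y yj i; apply: (le_trans (yj i)).
rewrite lef_pV2 ?posrE ?scale_gt0//.
have -> : scale 0 i = L by rewrite /scale expr0 mulr1; case: ifP.
exact: scale_ge.
Qed.

(** One rescaled coordinate beyond [1] is enough. Hence [cutoff] and [dcutoff] of [quad j] vanish
    off the box. *)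
Lemma notbox_quad j y : ~ box j y -> 1 <= quad j y.
Proof.
move=> /existsNP[i /negP]; rewrite -ltNge => h.
rewrite /quad (bigD1 i)//=; apply: ler_wpDr.
  by apply: sumr_ge0 => *; exact: sqr_ge0.
rewrite -real_normK ?num_real// exprn_ege1// normrM.
rewrite (gtr0_norm (scale_gt0 j i)) -ler_pdivrMl ?scale_gt0// mulr1.
exact: ltW.
Qed.

Let weight_ge0 j y : 0 <= logcut_bound * (2 ^+ j * \1_(box j) y).
Proof.
apply: mulr_ge0; first exact: logcut_bound_ge0.
by apply: mulr_ge0; [exact: exprn_ge0|rewrite indicE].
Qed.

(** The weight [2 ^+ j >= 1] is given away here, so that the same function controls values and
    gradients. *)
Lemma logcut_overlap N y : `|1 - logcut N y| <= logcut_bound * overlap N y.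
Proof.
rewrite /logcut opprB addrCA subrr addr0 /overlap mulrCA.
rewrite normrM ger0_norm ?invr_ge0// ler_wpM2l ?invr_ge0//.
rewrite mulr_sumr; apply: (le_trans (ler_norm_sum _ _ _)); apply: ler_sum => j _.
have K0 := cutoff_bound_ge0 R.
have [yb|yb] := pselect (box j y); last first.
  rewrite cutoff_eq0 ?normr0; last exact: notbox_quad.
  exact: weight_ge0.
rewrite indicE mem_set// mulr1; apply: (le_trans (cutoff_le _)).
have j1 : 1 <= 2 ^+ j :> R by rewrite exprn_ege1// ler1n.
rewrite /logcut_bound -mulrA; apply: ler_peMr => //.
by rewrite -[leLHS]mulr1 ler_pM//; have := L_gt0; lra.
Qed.

Lemma Ck_quad k m (U : set 'rV[R]_m) (f : 'rV[R]_m -> V) j : open U ->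
  (forall i, Ck k U (fun x => f x ord0 i)) -> Ck k U (fun x => quad j (f x)).
Proof.
move=> oU cf; rewrite /quad; apply: (Ck_sum _ oU) => i.
have h : Ck k U (fun x => scale j i * (f x ord0 i + - p ord0 i)).
  by apply: (Ck_mul oU (Ck_cst _ _ _)); exact: (Ck_add oU (cf i) (Ck_cst _ _ _)).
exact: (Ck_mul oU h h).
Qed.

Lemma Ck_logcut k m (U : set 'rV[R]_m) (f : 'rV[R]_m -> V) N : open U ->
  (forall i, Ck k U (fun x => f x ord0 i)) -> Ck k U (fun x => logcut N (f x)).
Proof.
move=> oU cf; rewrite /logcut.
have -> : (fun x => 1 - N%:R^-1 * (\sum_(j < N) cutoff (quad j (f x)))) =
  (fun x => 1 + (- N%:R^-1) * (\sum_(j < N) cutoff (quad j (f x)))).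
  by apply/funext => x; rewrite mulNr.
apply: (Ck_add oU (Ck_cst _ _ _)); apply: (Ck_mul oU (Ck_cst _ _ _)).
by apply: (Ck_sum _ oU) => j; apply: (Ck_cutoff oU); exact: Ck_quad.
Qed.

Lemma is_derive_quad j (v y : V) : is_derive y v (quad j)
  (\sum_i 2 * scale j i ^+ 2 * (y ord0 i - p ord0 i) * v ord0 i).
Proof.
have h i : is_derive y v (fun z : V => (scale j i * (z ord0 i - p ord0 i)) ^+ 2)
    (2 * scale j i ^+ 2 * (y ord0 i - p ord0 i) * v ord0 i).
  have d0 : is_derive y v (fun z : V => z ord0 i) (v ord0 i).
    apply: DeriveDef; last exact: derive_coord.
    exact/diff_derivable/differentiable_coord.
  have d1 := is_deriveZ (scale j i) (is_deriveB d0 (is_derive_cst (p ord0 i) y v)).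
  apply: is_derive_eq (is_deriveX 2 d1) _.
  by rewrite /GRing.scale /= !fctE /GRing.scale /= subr0 expr1; ring.
have -> : quad j = \sum_i (fun z : V => (scale j i * (z ord0 i - p ord0 i)) ^+ 2).
  by apply/funext => z; rewrite fct_sumE.
exact: is_derive_sum.
Qed.

Lemma derive_logcut N (v y : V) : 'D_v (logcut N) y = - (N%:R^-1 *
  \sum_(j < N) dcutoff (quad j y) *
     \sum_i 2 * scale j i ^+ 2 * (y ord0 i - p ord0 i) * v ord0 i).
Proof.
have h (j : 'I_N) : is_derive y v (fun z => cutoff (quad j z))
    (dcutoff (quad j y) *
     \sum_i 2 * scale j i ^+ 2 * (y ord0 i - p ord0 i) * v ord0 i).
  have dq : differentiable (quad j) y.
    have [] : Ck 1 setT (fun x : V => quad j (id x)).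
      by apply: Ck_quad; [exact: openT|move=> i; exact: Ck_coord].
    by move=> + _; apply.
  have dc := is_derive_cutoff (quad j y).
  have dcq : differentiable (@cutoff R) (quad j y).
    by apply/derivable1_diffP; case: dc.
  apply: DeriveDef; first exact: diff_derivable (differentiable_comp dq dcq).
  rewrite (@derive_comp _ _ (quad j) (@cutoff R))//.
  by have dj := is_derive_quad j v y; rewrite !derive_val.
have -> : logcut N = cst 1 - (N%:R^-1 \*: (\sum_(j < N) (fun z => cutoff (quad j z)))).
  by apply/funext => z; rewrite /logcut !fctE fct_sumE.
have := is_deriveB (is_derive_cst (1 : R) y v) (is_deriveZ N%:R^-1 (is_derive_sum h)).
by move=> D; rewrite derive_val sub0r.
Qed.

(** The derivative of [quad j] carries [scale j i] squared. On the box one factor is absorbed by the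
    rescaled coordinate, which is at most [1], and the other is at most [L * 2 ^+ j]; off the box
    [dcutoff] vanishes. *)
Lemma derive_logcut_overlap N i y :
  `|'D_(delta_mx ord0 i) (logcut N) y| <= logcut_bound * overlap N y.
Proof.
rewrite derive_logcut normrN /overlap mulrCA.
rewrite normrM ger0_norm ?invr_ge0// ler_wpM2l ?invr_ge0//.
rewrite mulr_sumr; apply: (le_trans (ler_norm_sum _ _ _)); apply: ler_sum => j _.
have K0 := cutoff_bound_ge0 R.
have [yb|yb] := pselect (box j y); last first.
  rewrite dcutoff_eq0 ?mul0r ?normr0; last exact: notbox_quad.
  exact: weight_ge0.
rewrite indicE mem_set// mulr1 (bigD1 i)//= big1 ?addr0; last first.
  by move=> k ki; rewrite mxE eqxx /= (negbTE ki) mulr0.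
rewrite mxE !eqxx mulr1 normrM /logcut_bound -(mulrA (cutoff_bound R)).
apply: (ler_pM (normr_ge0 _) (normr_ge0 _) (dcutoff_le _)).
have s0 := scale_gt0 j i.
rewrite normrM (normrM 2) normr_nat (ger0_norm (exprn_ge0 2 (ltW s0))) expr2 -!mulrA.
have h : scale j i * `|y ord0 i - p ord0 i| <= 1.
  by rewrite -ler_pdivlMl// mulr1; exact: yb.
apply: (@le_trans _ _ (2 * (L * 2 ^+ j))).
  rewrite ler_pM2l// -[leRHS]mulr1 ler_pM//; first exact: ltW.
  - by rewrite mulr_ge0// ltW.
  - exact: scale_le.
rewrite mulrA ler_wpM2r ?exprn_ge0//; lra.
Qed.

(** Adding the term [t = 2 ^+ N] to the sum [S] of the previous ones increases the square by
    [2 S t + t^2 <= 3 t^2], since [S <= t] by the geometric series; and [t^2 = 4 ^+ N]. *)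
Lemma sum_pow2_indic_sqr (b : nat -> bool) N :
  (\sum_(j < N) 2 ^+ j * (b j)%:R) ^+ 2 <= 3 * \sum_(j < N) 4 ^+ j * (b j)%:R :> R.
Proof.
have le2 m : \sum_(j < m) 2 ^+ j * (b j)%:R <= 2 ^+ m :> R.
  elim: m => [|m IH]; first by rewrite big_ord0 expr0.
  rewrite big_ord_recr /= exprS.
  have : 2 ^+ m * (b m)%:R <= 2 ^+ m :> R.
    by rewrite ler_piMr ?exprn_ge0//; case: (b m).
  by lra.
have ge0 m : 0 <= \sum_(j < m) 2 ^+ j * (b j)%:R :> R.
  by apply: sumr_ge0 => j _; rewrite mulr_ge0 ?exprn_ge0.
elim: N => [|N IH]; first by rewrite !big_ord0 expr0n mulr0.
rewrite !big_ord_recr /=; case: (b N); last by rewrite !mulr0 !addr0.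
have -> : 4 ^+ N = 2 ^+ N * 2 ^+ N :> R by rewrite -exprMn -natrM.
have := le2 N; have := ge0 N; move: IH.
set S := \sum_(j < N) _; set Q := \sum_(j < N) _; set t := 2 ^+ N.
have t0 : 0 < t by rewrite exprn_gt0.
move=> IH S0 St; rewrite !mulr1 sqrrD mulrDr.
have : S * t <= t * t by rewrite ler_pM2r.
by rewrite -mulr_natl expr2; lra.
Qed.

Lemma overlap_sqr N y :
  overlap N y ^+ 2 <= 3 / N%:R ^+ 2 * \sum_(j < N) 4 ^+ j * \1_(box j) y.
Proof.
rewrite /overlap exprMn exprVn (mulrC 3) -mulrA ler_wpM2l ?invr_ge0 ?exprn_ge0//.
exact: (sum_pow2_indic_sqr (fun j => y \in box j)).
Qed.

Lemma overlap_ge0 N y : 0 <= overlap N y.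
Proof.
rewrite /overlap mulr_ge0 ?invr_ge0//.
by apply: sumr_ge0 => j _; rewrite mulr_ge0 ?exprn_ge0.
Qed.

(** The Lebesgue measure of [box j]: the two rescaled coordinates contribute a factor [2^-j]
    each. *)
Lemma prod_scale j : (1 < n)%N ->
  \prod_i (2 * (scale j i)^-1) = (2 / L) ^+ n * 4^-1 ^+ j.
Proof.
move=> n1.
under eq_bigr => i _.
  rewrite (_ : _ * _ = (2 / L) * (if (n - 2 <= i)%N then 2^-1 ^+ j else 1)).
    over.
  rewrite /scale; case: ifP => _; last by rewrite mulr1.
  by rewrite invfM mulrA exprVn.
rewrite big_split /= prodr_const card_ord; congr (_ * _).
have -> : 4^-1 = 2^-1 * 2^-1 :> R by rewrite -invfM -natrM.
rewrite exprMn.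
by rewrite prod_last2.
Qed.

(** With [d = 2 n + 1], every rescaled coordinate is at most [1/d] for each [j < N], so that
    [quad j y <= n / d^2 <= 1/4] and all the bumps equal [1]. *)
Lemma logcut_eq0 N (y : V) : (0 < N)%N ->
  (forall i, `|y ord0 i - p ord0 i| <= (scale N i * (2 * n%:R + 1))^-1) ->
  logcut N y = 0.
Proof.
move=> N0 h; rewrite /logcut.
rewrite (eq_bigr (fun=> 1)) => [|j _].
  by rewrite sumr_const card_ord mulVf ?subrr// pnatr_eq0 -lt0n.
apply: cutoff_eq1; set d : R := 2 * n%:R + 1.
have d0 : 0 < d by rewrite /d; have := ler0n R n; lra.
apply: (@le_trans _ _ (\sum_(i < n) d^-1 ^+ 2)).
  apply: ler_sum => i _; rewrite -real_normK ?num_real//.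
  rewrite lerXn2r ?nnegrE ?invr_ge0 ?normr_ge0//; first exact: ltW.
  rewrite normrM (gtr0_norm (scale_gt0 j i)).
  apply: (@le_trans _ _ (scale N i * `|y ord0 i - p ord0 i|)).
    rewrite ler_wpM2r// /scale; case: ifP => // _.
    by rewrite ler_pM2l// ler_weXn2l ?ler1n// ltnW.
  by rewrite -ler_pdivlMl ?scale_gt0// -invfM; exact: h.
rewrite sumr_const card_ord -[leLHS]mulr_natl exprVn.
rewrite ler_pdivrMr ?exprn_gt0// /d; have := ler0n R n; have := sqr_ge0 (n%:R : R).
by rewrite sqrrD1 exprMn; lra.
Qed.

End LogCutoff.

(** * Charts *)

Lemma compact_continuous_le (R : realType) (T : topologicalType) (A : set T)
    (f : T -> R) : compact A -> (forall x, A x -> {for x, continuous f}) ->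
  exists C, forall x, A x -> `|f x| <= C.
Proof.
move=> cA cf.
have cfA : compact (f @` A).
  apply: continuous_compact => //.
  by apply: continuous_in_subspaceT => x /[1!inE]; exact: cf.
have [C [_ hC]] := compact_bounded cfA.
exists (C + 1) => x Ax; apply: (hC (C + 1)); first by rewrite ltrDl.
by exists x.
Qed.

Lemma box_compact (R : realType) n (p : 'rV[R]_n) L j : compact (box p L j).
Proof.
have -> : box p L j = [set v : 'rV[R]_n | forall i,
    `[p ord0 i - (scale L j i)^-1, p ord0 i + (scale L j i)^-1]%classic (v ord0 i)].
  apply/seteqP; split=> v /= h i; have := h i.
    by rewrite ler_norml in_itv /= => /andP[? ?]; apply/andP; split; lra.
  by rewrite in_itv /= ler_norml => /andP[? ?]; apply/andP; split; lra.
apply: (@rV_compact R n (fun i =>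
  `[p ord0 i - (scale L j i)^-1, p ord0 i + (scale L j i)^-1]%classic)) => i.
exact: segment_compact.
Qed.

Section ChartBox.
Variables (R : realType) (n : nat) (M : manifold R n).
Implicit Types (c : chart R n M) (U : set M).

(** Within the open range, the image is the preimage of [U] under [cinv c], which is continuous
    there. *)
Lemma chart_image_open c U : is_chart c -> open U ->
  open (cfun c @` (cdom c `&` U)).
Proof.
move=> [od orr cK _ cinv_cont] oU.
rewrite openE => _ [x [dx Ux] <-].
have ry : crange c (cfun c x) by exists x.
have nU : nbhs (cfun c x) (cinv c @^-1` U).
  by apply: (cinv_cont _ ry); rewrite cK//; exact: open_nbhs_nbhs.
apply: filterS (filterI nU (open_nbhs_nbhs (conj orr ry))) => z [Uz [w dw wz]].
by exists w => //; split=> //; move: Uz; rewrite /= -wz cK.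
Qed.

Lemma chart_nbhs_open c (V : set 'rV[R]_n) : is_chart c -> open V ->
  open (cdom c `&` cfun c @^-1` V).
Proof.
move=> [od orr cK cfun_cont _] oV; rewrite openE => x [dx Vx].
apply: filterI; first exact: open_nbhs_nbhs.
by apply: (cfun_cont x dx); exact: open_nbhs_nbhs.
Qed.

Section Box.
Variables (c : chart R n M) (hc : is_chart c) (p : 'rV[R]_n) (L : R).
Hypotheses (L_gt0 : 0 < L) (box_range : box p L 0 `<=` crange c).

Definition mbox (j : nat) : set M := cdom c `&` cfun c @^-1` box p L j.

(** As the box lies in the range of the chart, [mbox j] is its image under [cinv c]. Being compact
    in a Hausdorff space, it is closed in all of [M], not only in the chart domain. *)
Lemma mbox_compact j : compact (mbox j).
Proof.
have [od orr cK cf ci] := hc.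
have -> : mbox j = cinv c @` box p L j.
  apply/seteqP; split=> [x [dx bx]|_ [y yb <-]].
    by exists (cfun c x) => //; exact: cK.
  have [x dx xy] := box_range (box_subset L_gt0 yb).
  by split; rewrite /= -xy cK// xy.
apply: continuous_compact; last exact: box_compact.
apply: continuous_in_subspaceT => y /[1!inE] yb.
by apply: ci; apply: box_range; exact: box_subset yb.
Qed.

Lemma mbox_closed j : closed (mbox j).
Proof.
by apply: compact_closed; [exact: manifold_hausdorff|exact: mbox_compact].
Qed.

Lemma mbox_measurable j : measurable (mbox j : set (borel M)).
Proof.
rewrite -[mbox j]setCK; apply: measurableC; apply: sub_sigma_algebra.
by rewrite openC; exact: mbox_closed.
Qed.

Definition mlogcut (N : nat) (x : M) : R :=
  if `[< cdom c x >] then logcut p L N (cfun c x) else 1.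

Lemma mlogcut_dom N x : cdom c x -> mlogcut N x = logcut p L N (cfun c x).
Proof. by rewrite /mlogcut => dx; rewrite asboolT. Qed.

Lemma mlogcut_eq1 N x : ~ mbox 0 x -> mlogcut N x = 1.
Proof.
rewrite /mlogcut => xb; case: ifPn => // /asboolP dx.
have := logcut_overlap p L_gt0 N (cfun c x).
have -> : overlap p L N (cfun c x) = 0.
  rewrite /overlap big1 ?mulr0// => j _; rewrite indicE memNset ?mulr0// => bx.
  by apply: xb; split=> //; exact: box_subset bx.
by rewrite mulr0 normr_le0 subr_eq0 => /eqP.
Qed.

End Box.

Definition rsmooth (f : M -> R) : Prop :=
  forall c, atlas c -> smooth (cfun c @` cdom c) (f \o cinv c).

(** [M] is covered by two open sets: the chart domain, where smoothness is that of the transition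
    maps, and the complement of the closed [mbox 0], where the function is constantly [1]. *)
Lemma mlogcut_smooth c p L N : atlas c -> 0 < L -> box p L 0 `<=` crange c ->
  rsmooth (mlogcut c p L N).
Proof.
move=> ac L0 bc c' ac' k; apply: Ck_local => _ [x dx' <-].
have hc := atlas_chart ac; have hc' := atlas_chart ac'.
have [od orr cK _ _] := hc; have [od' orr' cK' _ _] := hc'.
have [dx|ndx] := pselect (cdom c x).
- have oW := chart_image_open hc' od.
  exists (cfun c' @` (cdom c' `&` cdom c)); first by exists x.
  apply: (@Ck_ext _ _ _ _ (fun y => logcut p L N (transition c' c y))) => //.
    move=> _ [z [dz' dz] <-]; rewrite /transition /comp (cK' _ dz').
    by rewrite (mlogcut_dom p L N dz).
  by apply: (Ck_logcut _ _ _ oW) => i; exact: atlas_compatible.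
- have oW := chart_image_open hc' (closed_openC (mbox_closed hc L0 bc (j := 0))).
  exists (cfun c' @` (cdom c' `&` ~` mbox c p L 0)).
    by exists x => //; split=> // -[].
  apply: (@Ck_ext _ _ _ _ (fun=> 1)) => //; last exact: Ck_cst.
  by move=> _ [z [dz' dz] <-]; rewrite /comp (cK' _ dz') (mlogcut_eq1 L0 N dz).
Qed.

End ChartBox.

(** * Complex bounds and fibre norms *)

Section ComplexSize.
Variable R : realType.
Implicit Types z w : R[i].

(** A norm equivalent to the modulus, still subadditive and submultiplicative, and free of square
    roots. *)
Definition cabs z : R := `|complex.Re z| + `|complex.Im z|.

Lemma cabs_ge0 z : 0 <= cabs z.
Proof. by rewrite addr_ge0. Qed.

Lemma cabs0 : cabs 0 = 0.
Proof. by rewrite /cabs /= normr0 addr0. Qed.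

Lemma cabsD z w : cabs (z + w) <= cabs z + cabs w.
Proof.
case: z w => [a b] [c d]; rewrite /cabs /= addrACA.
by apply: lerD; exact: ler_normD.
Qed.

Lemma cabsM z w : cabs (z * w) <= cabs z * cabs w.
Proof.
case: z w => [a b] [c d]; rewrite /cabs /=.
have := ler_normB (a * c) (b * d); have := ler_normD (a * d) (b * c).
by rewrite !normrM; lra.
Qed.

Lemma cabs_sum (I : Type) (s : seq I) (f : I -> R[i]) :
  cabs (\sum_(i <- s) f i) <= \sum_(i <- s) cabs (f i).
Proof.
elim: s => [|i s IH]; first by rewrite !big_nil cabs0.
by rewrite !big_cons; apply: (le_trans (cabsD _ _)); rewrite lerD2l.
Qed.

Lemma cabs_real (a : R) : cabs (Complex a 0) = `|a|.
Proof. by rewrite /cabs /= normr0 addr0. Qed.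

Lemma Re_realM (a : R) z : complex.Re (Complex a 0 * z) = a * complex.Re z.
Proof. by case: z => c d /=; rewrite mul0r subr0. Qed.

Lemma Im_realM (a : R) z : complex.Im (Complex a 0 * z) = a * complex.Im z.
Proof. by case: z => c d /=; rewrite mul0r addr0. Qed.

Definition cbounded (T : Type) (A : set T) (f : T -> R[i]) : Prop :=
  exists2 C, 0 <= C & forall x, A x -> cabs (f x) <= C.

Lemma cboundedD (T : Type) (A : set T) f g :
  cbounded A f -> cbounded A g -> cbounded A (fun x : T => f x + g x).
Proof.
move=> [C C0 hC] [D D0 hD]; exists (C + D); first exact: addr_ge0.
by move=> x Ax; apply: (le_trans (cabsD _ _)); apply: lerD; [exact: hC|exact: hD].
Qed.

Lemma cboundedM (T : Type) (A : set T) f g :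
  cbounded A f -> cbounded A g -> cbounded A (fun x : T => f x * g x).
Proof.
move=> [C C0 hC] [D D0 hD]; exists (C * D); first exact: mulr_ge0.
move=> x Ax; apply: (le_trans (cabsM _ _)).
by apply: ler_pM; rewrite ?cabs_ge0//; [exact: hC|exact: hD].
Qed.

Lemma cbounded_sum (T I : Type) (A : set T) (s : seq I) (f : I -> T -> R[i]) :
  (forall i, cbounded A (f i)) -> cbounded A (fun x => \sum_(i <- s) f i x).
Proof.
move=> h; elim: s => [|i s IH].
  by exists 0 => // x _; rewrite big_nil cabs0.
by under eq_fun do rewrite big_cons; exact: cboundedD.
Qed.

Lemma cbounded_continuous (T : topologicalType) (A : set T) (f : T -> R[i]) :
  compact A -> (forall x, A x -> {for x, continuous (fun x => complex.Re (f x))}) ->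
  (forall x, A x -> {for x, continuous (fun x => complex.Im (f x))}) ->
  cbounded A f.
Proof.
move=> cA cr ci.
have [C hC] := compact_continuous_le cA cr.
have [D hD] := compact_continuous_le cA ci.
exists (`|C| + `|D|); first exact: addr_ge0.
move=> x Ax; apply: lerD; apply: (le_trans _ (ler_norm _)); [exact: hC|exact: hD].
Qed.

Lemma csmooth_bounded n (U A : set 'rV[R]_n) f :
  compact A -> A `<=` U -> csmooth U f -> cbounded A f.
Proof.
move=> cA AU [sr si]; apply: cbounded_continuous => // x /AU Ux.
  exact: (sr 0%N).
exact: (si 0%N).
Qed.

End ComplexSize.

(** * Norms and frames in the fibres of a hermitian bundle *)

Section FibreNorm.
Variables (R : realType) (n : nat) (M : manifold R n) (r : nat).
Variable E : hermitian_bundle M r.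

Section Fibre.
Variable x : M.
Implicit Types u v w : E x.

(** The squared fibre norm; [herm w w] is real by hermitian symmetry. *)
Definition nsq w : R := complex.Re (herm w w).

Lemma herm0l w : herm (0 : E x) w = 0.
Proof.
have := herm_linear w 1 0 0; rewrite scaler0 addr0 mul1r.
by move=> /eqP; rewrite -subr_eq0 opprD addNKr oppr_eq0 => /eqP.
Qed.

Lemma hermDl u v w : herm (u + v) w = herm u w + herm v w.
Proof. by have := herm_linear w 1 u v; rewrite scale1r mul1r. Qed.

Lemma hermZl a u w : herm (a *: u) w = a * herm u w.
Proof. by have := herm_linear w a u 0; rewrite addr0 herm0l addr0. Qed.

Lemma hermDr u v w : herm w (u + v) = herm w u + herm w v.
Proof. by rewrite herm_conj hermDl rmorphD /= -!herm_conj. Qed.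

Lemma hermZr a u w : herm w (a *: u) = (a^*)%C * herm w u.
Proof. by rewrite herm_conj hermZl rmorphM /= -herm_conj. Qed.

Lemma nsq_ge0 w : 0 <= nsq w.
Proof.
have [->|w0] := eqVneq w 0; first by rewrite /nsq herm0l.
by have := herm_pos w0; rewrite ltcE /= => /andP[_ /ltW].
Qed.

Lemma nsq0 : nsq (0 : E x) = 0.
Proof. by rewrite /nsq herm0l. Qed.

(** The exact factor is the squared modulus of [a], which [cabs a ^+ 2] dominates. *)
Lemma nsqZ a w : nsq (a *: w) <= cabs a ^+ 2 * nsq w.
Proof.
have := nsq_ge0 w.
rewrite /nsq hermZl hermZr mulrA; case: a => a b; case: (herm w w) => c d.
rewrite /cabs /= => c0.
have -> : (a * a - b * - b) * c - (a * - b + b * a) * d = (a ^+ 2 + b ^+ 2) * c.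
  by ring.
rewrite ler_wpM2r// sqrrD !real_normK ?num_real//.
rewrite -addrA lerD2l lerDr mulrn_wge0// mulr_ge0.
Qed.

(** The parallelogram law, with the nonnegative term [nsq (u - v)] dropped. *)
Lemma nsqD u v : nsq (u + v) <= 2 * nsq u + 2 * nsq v.
Proof.
have := nsq_ge0 (u + (-1) *: v).
rewrite /nsq !hermDl !hermDr !hermZl !hermZr /=.
case: (herm u u) => ? ?; case: (herm u v) => ? ?; case: (herm v u) => ? ?.
by case: (herm v v) => ? ? /=; lra.
Qed.

Lemma nsq_sum (I : Type) (s : seq I) (f : I -> E x) :
  nsq (\sum_(i <- s) f i) <= 2 ^+ size s * \sum_(i <- s) nsq (f i).
Proof.
elim: s => [|i s IH]; first by rewrite !big_nil nsq0 mulr0.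
rewrite !big_cons /= exprS mulrDr; apply: (le_trans (nsqD _ _)); apply: lerD.
  by rewrite ler_wpM2r ?nsq_ge0// ler_peMr// exprn_ege1// ler1n.
by rewrite -mulrA ler_pM2l.
Qed.

End Fibre.

Section Trivialization.
Variables (t : trivialization E r) (ht : trivs t) (x : M) (tx : tdom t x).

Let lin : linear (@tfun _ _ _ _ t x).
Proof. by have [] := triv_iso ht tx. Qed.

Lemma tfunD (u v : E x) : tfun t (u + v) = tfun t u + tfun t v.
Proof. by have := lin 1 u v; rewrite !scale1r. Qed.

Lemma tfun0 : tfun t (0 : E x) = 0.
Proof.
have := tfunD 0 0; rewrite addr0 => /eqP.
by rewrite -subr_eq0 opprD addNKr oppr_eq0 => /eqP.
Qed.

Lemma tfunZ a (u : E x) : tfun t (a *: u) = a *: tfun t u.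
Proof. by have := lin a u 0; rewrite !addr0 tfun0 addr0. Qed.

Lemma tfunB (u v : E x) : tfun t (u - v) = tfun t u - tfun t v.
Proof. by rewrite tfunD -scaleN1r tfunZ scaleN1r. Qed.

Lemma tfun_inj : injective (@tfun _ _ _ _ t x).
Proof. by have [_ K _] := triv_iso ht tx; exact: can_inj K. Qed.

Lemma tfun_decomp (u : E x) :
  u = \sum_(k < r) tfun t u k ord0 *: tinv t x (delta_mx k ord0).
Proof.
have [_ _ K] := triv_iso ht tx; apply: tfun_inj.
rewrite (big_morph _ tfunD tfun0) [LHS]matrix_sum_delta.
by apply: eq_bigr => k _; rewrite big_ord1 tfunZ K.
Qed.

(* The constant comes from applying [nsqD] [r] times. *)
Lemma nsq_le_components (u : E x) (C H : R) :
  0 <= C -> (forall k, cabs (tfun t u k ord0) <= C) ->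
  (forall k, nsq (tinv t x (delta_mx k ord0)) <= H) ->
  nsq u <= 2 ^+ r * (r%:R * H) * C ^+ 2.
Proof.
move=> C0 hC hH; rewrite [in leLHS](tfun_decomp u); apply: (le_trans (nsq_sum _ _)).
have -> : size (index_enum (ordinal r)) = r.
  by rewrite [index_enum _]unlock -enumT size_enum_ord.
rewrite -mulrA ler_pM2l ?exprn_gt0//.
apply: (@le_trans _ _ (\sum_(k < r) C ^+ 2 * H)).
  apply: ler_sum => k _; apply: (le_trans (nsqZ _ _)).
  rewrite ler_pM ?nsq_ge0 ?exprn_ge0 ?cabs_ge0//.
  by rewrite lerXn2r ?nnegrE ?cabs_ge0.
by rewrite sumr_const card_ord -[leLHS]mulr_natl (mulrC _ H) mulrA.
Qed.

End Trivialization.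

End FibreNorm.

(** * Commutators of first-order operators with functions *)

Section Operator.
Variables (R : realType) (n : nat) (M : manifold R n) (r : nat).
Variable E : hermitian_bundle M r.
Implicit Types (f : M -> R) (u v : section E).

Definition mulsec f u : section E := fun x => Complex (f x) 0 *: u x.

Lemma mulsec_smooth f u : rsmooth f -> smooth_section u ->
  smooth_section (mulsec f u).
Proof.
move=> sf su t ht i c ac; have hc := atlas_chart ac.
have [_ _ cK _ _] := hc.
have oW := chart_image_open hc (triv_open ht).
have sub : cfun c @` (cdom c `&` tdom t) `<=` cfun c @` cdom c.
  by move=> _ [x [dx _] <-]; exists x.
have E1 y : (cfun c @` (cdom c `&` tdom t)) y ->
    tfun t (mulsec f u (cinv c y)) i ord0 =
    Complex (f (cinv c y)) 0 * tfun t (u (cinv c y)) i ord0.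
  by move=> [x [dx tx] <-]; rewrite cK// /mulsec (tfunZ ht tx) mxE.
have [sr si] := su t ht i c ac.
split=> k.
  apply: (@Ck_ext _ _ _ _ (fun y => (f \o cinv c) y *
      complex.Re (tfun t (u (cinv c y)) i ord0))) => //.
    by move=> y Wy; rewrite /comp E1// Re_realM.
  apply: (Ck_mul oW); first exact: Ck_subset (sf c ac k).
  exact: sr.
apply: (@Ck_ext _ _ _ _ (fun y => (f \o cinv c) y *
    complex.Im (tfun t (u (cinv c y)) i ord0))) => //.
  by move=> y Wy; rewrite /comp E1// Im_realM.
apply: (Ck_mul oW); first exact: Ck_subset (sf c ac k).
exact: si.
Qed.

(** Vanishing on an open set around [K], and not only on [K], keeps the closed support away from
    [K]. *)
Lemma mulsec_Gamma f u (W K O : set M) : Gamma_c E W u -> rsmooth f ->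
  open O -> (forall x, O x -> f x = 0) -> K `<=` O ->
  Gamma_c E (W `\` K) (mulsec f u).
Proof.
move=> [su cu uW] sf oO f0 KO.
have sub : section_support (mulsec f u) `<=` section_support u.
  apply: closureS => x /=; apply: contra_neq; rewrite /mulsec => ->.
  by rewrite scaler0.
split; first exact: mulsec_smooth.
  by apply: (subclosed_compact _ cu sub); exact: closed_closure.
move=> x xs; split; first by apply: uW; exact: sub.
move=> /KO Ox.
suff : closure (~` O) x.
  by have /closure_id <- : closed (~` O) by exact: open_closedC.
apply: closureS xs => y /= /eqP h Oy; apply: h.
have -> : mulsec f u y = Complex 0 0 *: u y by rewrite /mulsec f0.
exact: scale0r.
Qed.

Lemma Gamma_c_subset (W W' : set M) : W `<=` W' -> Gamma_c E W `<=` Gamma_c E W'.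
Proof. by move=> WW' u [? ? uW]; split=> //; exact: subset_trans WW'. Qed.

Variables (D : section E -> section E) (hD : first_order_operator D).

(** [D] is an arbitrary map on sections; locality comes from its coordinate expression, whose
    derivatives depend only on the section near the point. *)
Lemma D_local u v (O : set M) (x : M) : Gamma_c E setT u -> Gamma_c E setT v ->
  open O -> O x -> (forall z, O z -> u z = v z) -> D u x = D v x.
Proof.
move=> Gu Gv oO Ox uv.
have [c ac dx] := atlas_cover x; have [t ht tx] := triv_cover E x.
have hc := atlas_chart ac; have [_ _ cK _ _] := hc.
have [a [b [_ _ hab]]] := hD ac ht.
apply: (tfun_inj ht tx).
have Wx : (cdom c `&` tdom t) x by [].
rewrite (hab u Gu x Wx) (hab v Gv x Wx) (uv x Ox); congr (_ + _).
apply: eq_bigr => i _; congr (_ *m _); apply/colP => l; rewrite !mxE.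
have nuv : \forall z \near cfun c x, u (cinv c z) = v (cinv c z).
  have oI := chart_image_open hc oO.
  have Ix : (cfun c @` (cdom c `&` O)) (cfun c x) by exists x.
  apply: filterS (open_nbhs_nbhs (conj oI Ix)) => _ [z [dz Oz] <-].
  by rewrite cK//; exact: uv.
by congr (Complex _ _); apply: near_eq_derive; apply: filterS nuv => z ->.
Qed.

Lemma cderive_mul f u (c : chart R n M) (t : trivialization E r) (w : 'rV[R]_n) x l :
  atlas c -> trivs t -> rsmooth f -> smooth_section u -> cdom c x -> tdom t x ->
  let y := cfun c x in
  cderive w (fun z => tfun t (mulsec f u (cinv c z))) y l ord0 =
  Complex (f x) 0 * cderive w (fun z => tfun t (u (cinv c z))) y l ord0 +
  Complex ('D_w (f \o cinv c) y) 0 * tfun t (u x) l ord0.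
Proof.
move=> ac ht sf su dx tx y; rewrite /y {y}.
have hc := atlas_chart ac; have [_ _ cK _ _] := hc.
have oW := chart_image_open hc (triv_open ht).
have Wy : (cfun c @` (cdom c `&` tdom t)) (cfun c x) by exists x.
have nE : \forall z \near cfun c x, tfun t (mulsec f u (cinv c z)) l ord0 =
    Complex ((f \o cinv c) z) 0 * tfun t (u (cinv c z)) l ord0.
  apply: filterS (open_nbhs_nbhs (conj oW Wy)) => _ [z [dz tz] <-].
  by rewrite /comp cK// /mulsec (tfunZ ht tz) mxE.
have [df _] := sf c ac 1%N.
have dfx : differentiable (f \o cinv c) (cfun c x) by apply: df; exists x.
have [sr si] := su t ht l c ac.
have drx := (sr 1%N).1 _ Wy; have dix := (si 1%N).1 _ Wy.
rewrite !mxE.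
have -> : 'D_w (fun z => complex.Re (tfun t (mulsec f u (cinv c z)) l ord0)) (cfun c x)
   = 'D_w ((f \o cinv c) *
       (fun z => complex.Re (tfun t (u (cinv c z)) l ord0))) (cfun c x).
  by apply: near_eq_derive; apply: filterS nE => z ->; rewrite Re_realM.
have -> : 'D_w (fun z => complex.Im (tfun t (mulsec f u (cinv c z)) l ord0)) (cfun c x)
   = 'D_w ((f \o cinv c) *
       (fun z => complex.Im (tfun t (u (cinv c z)) l ord0))) (cfun c x).
  by apply: near_eq_derive; apply: filterS nE => z ->; rewrite Im_realM.
rewrite !deriveM; try exact: diff_derivable.
rewrite /GRing.scale /= cK//; case: (tfun t (u x) l ord0) => p q /=.
by congr Complex; ring.
Qed.

(** In coordinates [D (f u) - D u = (f - 1) D u + \sum_i (d_i f) a_i u]. On the compact [A] both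
    [D u] and the [a_i u] have bounded components, by a constant that depends on [u] but not on
    [f]. *)
Lemma commutator_bound (c : chart R n M) (t : trivialization E r) (A : set 'rV[R]_n) u :
  atlas c -> trivs t -> compact A -> A `<=` cfun c @` (cdom c `&` tdom t) ->
  Gamma_c E setT u ->
  exists2 C, 0 <= C & forall f, rsmooth f -> Gamma_c E setT (mulsec f u) ->
    forall x, cdom c x -> tdom t x -> A (cfun c x) ->
    forall s, `|1 - f x| <= s ->
    (forall i, `|'D_(delta_mx ord0 i) (f \o cinv c) (cfun c x)| <= s) ->
    forall k, cabs (tfun t (D (mulsec f u) x - D u x) k ord0) <= C * s.
Proof.
move=> ac ht cA AW Gu; have [a [b [sa sb hab]]] := hD ac ht.
have hc := atlas_chart ac; have [_ _ cK _ _] := hc.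
have su : smooth_section u by case: Gu.
pose U z := tfun t (u (cinv c z)).
(* [F] is the coordinate expression of [D u], and [G i] that of [a_i u], the coefficient of
   [d_i f]. *)
pose F k y := (\sum_(i < n) a i y *m cderive (delta_mx ord0 i) U y + b y *m U y) k ord0.
pose G i k y := (a i y *m U y) k ord0.
have bU k : cbounded A (fun y => U y k ord0).
  exact: csmooth_bounded cA AW (su t ht k c ac).
have ba i k l : cbounded A (fun y => a i y k l).
  exact: csmooth_bounded cA AW (sa _ _ _).
have bb k l : cbounded A (fun y => b y k l).
  exact: csmooth_bounded cA AW (sb _ _).
have bd i k : cbounded A (fun y => cderive (delta_mx ord0 i) U y k ord0).
  have [sr si] := su t ht k c ac.
  under eq_fun do rewrite mxE.
  apply: cbounded_continuous => // y Ay.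
    exact: ((sr 1%N).2 (delta_mx ord0 i) y (AW y Ay)).
  exact: ((si 1%N).2 (delta_mx ord0 i) y (AW y Ay)).
have bG i k : cbounded A (G i k).
  rewrite /G; under eq_fun do rewrite mxE.
  by apply: cbounded_sum => l; exact: cboundedM.
have bF k : cbounded A (F k).
  rewrite /F; under eq_fun do rewrite mxE summxE mxE.
  apply: cboundedD.
    apply: cbounded_sum => i; under eq_fun do rewrite mxE.
    by apply: cbounded_sum => l; exact: cboundedM.
  by apply: cbounded_sum => l; exact: cboundedM.
have /choice[CF hCF] : forall k, exists C, 0 <= C /\ forall y, A y -> cabs (F k y) <= C.
  by move=> k; have [C C0 hC] := bF k; exists C.
have /choice[CG hCG] : forall ik : 'I_n * 'I_r,
    exists C, 0 <= C /\ forall y, A y -> cabs (G ik.1 ik.2 y) <= C.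
  by move=> [i k]; have [C C0 hC] := bG i k; exists C.
pose C k := CF k + \sum_i CG (i, k).
have C0 k : 0 <= C k.
  by apply: addr_ge0; [exact: (hCF k).1|apply: sumr_ge0 => i _; exact: (hCG (i, k)).1].
exists (\sum_k C k); first exact: sumr_ge0.
move=> f sf Gfu x dx tx Ax s s1 sD k.
have s0 : 0 <= s by exact: le_trans s1.
have Wx : (cdom c `&` tdom t) x by [].
have -> : tfun t (D (mulsec f u) x - D u x) k ord0 =
    Complex (f x - 1) 0 * F k (cfun c x) +
    \sum_i Complex ('D_(delta_mx ord0 i) (f \o cinv c) (cfun c x)) 0 * G i k (cfun c x).
  rewrite (tfunB ht tx) (hab _ Gfu x Wx) (hab _ Gu x Wx) /F /G.
  have -> : tfun t (mulsec f u x) = Complex (f x) 0 *: tfun t (u x).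
    by rewrite /mulsec (tfunZ ht tx).
  have -> : U (cfun c x) = tfun t (u x) by rewrite /U cK.
  have hd i : cderive (delta_mx ord0 i) (fun z => tfun t (mulsec f u (cinv c z)))
      (cfun c x) = Complex (f x) 0 *: cderive (delta_mx ord0 i) U (cfun c x) +
      Complex ('D_(delta_mx ord0 i) (f \o cinv c) (cfun c x)) 0 *: tfun t (u x).
    apply/colP => l; rewrite (cderive_mul _ l ac ht sf su dx tx).
    by rewrite [RHS]mxE; congr (_ + _); rewrite [RHS]mxE.
  under eq_bigr do rewrite hd mulmxDr -!scalemxAr.
  rewrite big_split /= -scaler_sumr -scalemxAr.
  have -> : Complex (f x - 1) 0 = Complex (f x) 0 - 1 :> R[i].
    by apply/eqP; rewrite eq_complex /= oppr0 addr0 !eqxx.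
  set z := Complex (f x) 0; set S := \sum_(i < n) _; set T := \sum_(i < n) _.
  set B := b _ *m _.
  have -> : z *: S + T + z *: B - (S + B) = (z - 1) *: (S + B) + T.
    rewrite scalerBl scale1r scalerDr -!addrA; congr (_ + _).
    by rewrite [LHS]addrC -addrA.
  rewrite [LHS]mxE [in LHS]mxE; congr (_ + _).
  by rewrite /T summxE; apply: eq_bigr => i _; rewrite mxE.
apply: (@le_trans _ _ (C k * s)); last first.
  rewrite ler_wpM2r// (bigD1 k)//= lerDl; exact: sumr_ge0.
rewrite /C mulrDl mulr_suml; apply: (le_trans (cabsD _ _)); apply: lerD.
  apply: (le_trans (cabsM _ _)); rewrite cabs_real mulrC distrC.
  by apply: ler_pM; rewrite ?cabs_ge0//; exact: (hCF k).2.
apply: (le_trans (cabs_sum _ _)); apply: ler_sum => i _.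
apply: (le_trans (cabsM _ _)); rewrite cabs_real mulrC.
by apply: ler_pM; rewrite ?cabs_ge0//; exact: (hCG (i, k)).2.
Qed.

End Operator.

(** * Estimates in a slice chart *)

(** The weights [4 ^+ j] cancel the decay of the measures, so each of the [N] terms contributes at
    most [C]. The factor [3 / N^2] of [decay] then leaves [O(1/N)]. *)
Lemma integral_weighted_indic d (T : measurableType d) (R : realType)
    (mu : {measure set T -> \bar R}) (B : nat -> set T) (a C : R) N :
  (forall j, measurable (B j)) -> 0 <= a ->
  (forall j, (mu (B j) <= (C * 4^-1 ^+ j)%:E)%E) ->
  (\int[mu]_(x in [set: T]) (a * \sum_(j < N) 4 ^+ j * \1_(B j) x)%:E <=
   (a * (N%:R * C))%:E)%E.
Proof.
move=> mB a0 hB.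
have m1 j : measurable_fun [set: T] (fun x => (\1_(B j) x)%:E : \bar R).
  by apply/measurable_EFinP; exact: measurable_indic.
under eq_integral do rewrite EFinM -sumEFin.
rewrite ge0_integralZl//; last 2 first.
- apply: emeasurable_sum => j; under eq_fun do rewrite EFinM.
  exact: measurable_funeM.
- by move=> x _; apply: sume_ge0 => j _; rewrite lee_fin mulr_ge0 ?exprn_ge0.
rewrite ge0_integral_sum//; last first.
  by move=> j; under eq_fun do rewrite EFinM; exact: measurable_funeM.
rewrite EFinM; apply: lee_wpmul2l; first by rewrite lee_fin.
have -> : (N%:R * C)%:E = (\sum_(j < N) C%:E)%E.
  by rewrite sumEFin sumr_const card_ord mulr_natl.
apply: lee_sum => j _; under eq_integral do rewrite EFinM.
rewrite ge0_integralZl//.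
rewrite integral_indic// setIT.
apply: (@le_trans _ _ ((4 ^+ j)%:E * (C * 4^-1 ^+ j)%:E)%E).
  by apply: lee_wpmul2l => //; rewrite lee_fin exprn_ge0.
by rewrite -EFinM lee_fin mulrCA -exprMn divff// expr1n mulr1.
Qed.

Section SliceEstimates.
Variables (R : realType) (n : nat) (M : manifold R n) (r : nat).
Variables (g : riemannian_metric M) (mu : {measure set (borel M) -> \bar R}).
Hypothesis hmu : is_riemannian_measure g mu.
Variable E : hermitian_bundle M r.

Lemma det_continuous (c : chart R n M) y : atlas c -> crange c y ->
  {for y, continuous (fun z => \det (gmat g c z))}.
Proof.
move=> ac; have [_ oc _ _ _] := atlas_chart ac; apply: (_ : Ck 0 (crange c) _).
(* The Leibniz expansion writes the determinant as a sum of products of metric components. *)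
apply: (Ck_sum _ oc) => s; apply: (Ck_mul oc (Ck_cst _ _ _)).
by apply: (Ck_prod _ oc) => i; exact: gmat_smooth.
Qed.

(** The density is bounded on the compact [box 0], so the measure is at most a constant times the
    Lebesgue measure of [box j]. *)
Lemma mu_mbox (c : chart R n M) (p : 'rV[R]_n) (L : R) :
  (1 < n)%N -> atlas c -> 0 < L -> box p L 0 `<=` crange c ->
  exists2 C, 0 <= C & forall j, (mu (mbox c p L j) <= (C * 4^-1 ^+ j)%:E)%E.
Proof.
move=> n1 ac L0 bc; have hc := atlas_chart ac.
have [G hG] : exists G, forall y, box p L 0 y -> `|\det (gmat g c y)| <= G.
  apply: compact_continuous_le; first exact: box_compact.
  by move=> y /bc; exact: det_continuous.
pose S := Num.sqrt G.
exists (S * (2 / L) ^+ n).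
  by rewrite mulr_ge0 ?sqrtr_ge0// exprn_ge0// divr_ge0// ltW.
move=> j; rewrite (hmu ac (mbox_measurable hc L0 bc j)); last by move=> x [].
rewrite -mulrA -prod_scale//; apply: (@lebesgue_int_box _ _ p).
- by move=> i; rewrite invr_ge0 ltW// scale_gt0.
- exact: sqrtr_ge0.
- by move=> y; rewrite lee_fin mulr_ge0 ?sqrtr_ge0.
- move=> y; rewrite lee_fin indicE; case: (boolP (y \in _)) => [|_]; last first.
    by rewrite mul0r sqrtr_ge0.
  rewrite inE => -[x [dx xb] <-]; rewrite mul1r ler_wsqrtr//.
  by apply: (le_trans (ler_norm _)); apply: hG; exact: box_subset xb.
- move=> y yb; rewrite indicE memNset ?mul0r// => -[x [dx xb] xy].
  by apply: yb; rewrite -xy; exact: xb.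
Qed.

(** The majorant of the squared [overlap] given by [overlap_sqr], carried over to a measurable
    function on all of [M]. *)
Definition decay (c : chart R n M) (p : 'rV[R]_n) (L : R) (N : nat) (x : M) : R :=
  3 / N%:R ^+ 2 * \sum_(j < N) 4 ^+ j * \1_(mbox c p L j) x.

Lemma decay_ge0 c p L N x : 0 <= decay c p L N x.
Proof.
rewrite /decay mulr_ge0 ?divr_ge0 ?exprn_ge0//.
by apply: sumr_ge0 => j _; rewrite mulr_ge0 ?exprn_ge0.
Qed.

Lemma overlap_decay c p L N x : cdom c x ->
  overlap p L N (cfun c x) ^+ 2 <= decay c p L N x.
Proof.
move=> dx; apply: (le_trans (overlap_sqr _ _ _ _)).
rewrite /decay ler_wpM2l ?divr_ge0 ?exprn_ge0//.
apply: ler_sum => j _; rewrite !indicE.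
case: (boolP (cfun c x \in _)) => [|_]; last by rewrite mulr0 mulr_ge0 ?exprn_ge0.
by rewrite inE => xb; rewrite mem_set//; split.
Qed.

Lemma measurable_decay c p L N : atlas c -> 0 < L -> box p L 0 `<=` crange c ->
  measurable_fun [set: borel M] (decay c p L N : borel M -> R).
Proof.
move=> ac L0 bc; apply: measurable_funM => //.
apply: measurable_sum => j; apply: measurable_funM => //.
by apply: measurable_indic; apply: mbox_measurable => //; exact: atlas_chart.
Qed.

(** Bounds on components become bounds on fibre norms, the frame having bounded norm over the
    compact box. [H] is fixed before [C], [N] and [w]. *)
Lemma nsq_decay (c : chart R n M) (t : trivialization E r) p L :
  atlas c -> trivs t -> 0 < L -> box p L 0 `<=` cfun c @` (cdom c `&` tdom t) ->
  exists2 H, 0 <= H & forall (C : R) N (w : section E), 0 <= C ->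
    (forall x, ~ mbox c p L 0 x -> w x = 0) ->
    (forall x k, mbox c p L 0 x -> tdom t x ->
       cabs (tfun t (w x) k ord0) <= C * overlap p L N (cfun c x)) ->
    forall x, nsq (w x) <= H * C ^+ 2 * decay c p L N x.
Proof.
move=> ac ht L0 bc; have hc := atlas_chart ac; have [_ _ cK _ _] := hc.
have hk k : exists H, 0 <= H /\ forall y, box p L 0 y ->
    cabs (herm (tinv t (cinv c y) (delta_mx k ord0))
               (tinv t (cinv c y) (delta_mx k ord0))) <= H.
  have [H H0 hH] := csmooth_bounded (@box_compact _ _ p L 0) bc (herm_smooth ht k k ac).
  by exists H.
have /choice[H hH] := hk.
have K0 : 0 <= 2 ^+ r * (r%:R * \sum_k H k) :> R.
  apply: mulr_ge0; first exact: exprn_ge0.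
  by apply: mulr_ge0; rewrite ?ler0n//; apply: sumr_ge0 => k _; exact: (hH k).1.
exists (2 ^+ r * (r%:R * \sum_k H k)) => //.
move=> C N w C0 w0 wC x.
have [xb|xb] := pselect (mbox c p L 0 x); last first.
  rewrite w0// nsq0; apply: mulr_ge0; last exact: decay_ge0.
  by apply: mulr_ge0 => //; exact: exprn_ge0.
have [dx bx] := xb.
have tx : tdom t x.
  by have [z [dz tz] zx] := bc _ bx; rewrite -(cK _ dx) -zx cK.
apply: (@le_trans _ _ (2 ^+ r * (r%:R * \sum_k H k) *
    (C * overlap p L N (cfun c x)) ^+ 2)).
  apply: (nsq_le_components ht tx); first by rewrite mulr_ge0// overlap_ge0.
    by move=> k; exact: wC.
  move=> k; rewrite (bigD1 k)//=; apply: ler_wpDr.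
    by apply: sumr_ge0 => l _; exact: (hH l).1.
  apply: le_trans ((hH k).2 _ bx); rewrite cK// /nsq /cabs.
  by apply: ler_wpDr => //; exact: ler_norm.
rewrite -[leRHS]mulrA ler_wpM2l// exprMn ler_wpM2l ?exprn_ge0//.
exact: overlap_decay.
Qed.

(** Splits [v - w] into [(v - u) + (u - w)]. Only the majorant [F] of the first part is known to be
    measurable, which is what [integral_le_addl] asks for. *)
Lemma L2distsq_le (u v w : section E) (F : borel M -> R) :
  measurable_fun [set: borel M] F -> (forall x, nsq (v x - u x) <= F x) ->
  (L2distsq mu v w <= \int[mu]_(x in [set: borel M]) (2 * F x)%:E +
    2%:E * L2distsq mu u w)%E.
Proof.
move=> mF vF; have F0 x : 0 <= F x by exact: le_trans (nsq_ge0 _) (vF x).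
apply: integral_le_addl => //.
- by move=> x; rewrite lee_fin; exact: nsq_ge0.
- by apply/measurable_EFinP; exact: measurable_funM.
- by move=> x; rewrite lee_fin mulr_ge0.
- by move=> x; rewrite ltry.
- by move=> x; rewrite lee_fin; exact: nsq_ge0.
move=> x; rewrite -EFinM -EFinD lee_fin.
have -> : v x - w x = (v x - u x) + (u x - w x) by rewrite addrA subrK.
by apply: (le_trans (nsqD _ _)); rewrite lerD2r ler_pM2l.
Qed.

End SliceEstimates.

(** * Removable sets *)

Lemma open_coordinate_box (R : realType) n (p : 'rV[R]_n) (w : 'I_n -> R) :
  open [set y : 'rV[R]_n | forall i, `|y ord0 i - p ord0 i| < w i].
Proof.
rewrite openE => y hy; apply: (@filter_forall _ _
  (fun i => [set z : 'rV[R]_n | `|z ord0 i - p ord0 i| < w i]) (nbhs y)) => i.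
have h : {for y, continuous (fun z : 'rV[R]_n => `|z ord0 i - p ord0 i|)}.
  have h0 : {for y, continuous (fun z : 'rV[R]_n => z ord0 i - p ord0 i)}.
    exact: (continuousB (@coord_continuous _ _ _ ord0 i y) (@cst_continuous _ _ _ y)).
  exact: (continuous_comp h0 (@norm_continuous _ _ _)).
exact: (h [set v | v < w i] (lt_nbhsl (hy i))).
Qed.

Section Removable.
Variables (R : realType) (n : nat) (M : manifold R n) (r : nat).
Variables (g : riemannian_metric M) (mu : {measure set (borel M) -> \bar R}).
Hypothesis hmu : is_riemannian_measure g mu.
Variables (E : hermitian_bundle M r) (D : section E -> section E).
Hypothesis hD : first_order_operator D.

(** Quantified over [W] so that removals can be iterated: once one set is removed, the next is
    removed from what is left. *)
Definition removable (K : set M) : Prop := forall W,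
  op_closure mu (op_graph D (Gamma_c E W)) `<=`
  op_closure mu (op_graph D (Gamma_c E (W `\` K))).

Lemma op_closure_mono (G G' : set (section E * section E)) :
  G `<=` G' -> op_closure mu G `<=` op_closure mu G'.
Proof.
move=> GG' q [? ? h]; split=> // e e0; have [q' [Gq' ? ?]] := h e e0.
by exists q'; split=> //; exact: GG'.
Qed.

Lemma op_graph_mono (W W' : set M) : W `<=` W' ->
  op_graph D (Gamma_c E W) `<=` op_graph D (Gamma_c E W').
Proof. by move=> WW' _ [u Gu <-]; exists u => //; exact: Gamma_c_subset Gu. Qed.

Lemma removable_subset (K K' : set M) : K `<=` K' -> removable K' -> removable K.
Proof.
move=> KK' rK' W; apply: (subset_trans (rK' W)).
by apply: op_closure_mono; apply: op_graph_mono => x [Wx K'x]; split=> // /KK'.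
Qed.

Lemma removable_bigcup (I : eqType) (s : seq I) (K : I -> set M) :
  (forall i, i \in s -> removable (K i)) ->
  removable [set x | exists2 i, i \in s & K i x].
Proof.
elim: s => [|i s IH] h W.
  by apply: op_closure_mono; apply: op_graph_mono => x Wx; split=> // -[].
have h1 : removable [set x | exists2 i, i \in s & K i x].
  by apply: IH => j js; apply: h; rewrite inE js orbT.
apply: (subset_trans (h i (mem_head _ _) W)).
apply: (subset_trans (h1 _)).
apply: op_closure_mono; apply: op_graph_mono => x [[Wx Kx] sx]; split=> //.
by move=> [j]; rewrite inE => /orP[/eqP ->//|js] Kjx; apply: sx; exists j.
Qed.

(* The [N]-th cutoff changes the graph norm of a fixed
   section by [O(1/N)]. *)
Lemma slice_removable (c : chart R n M) (x0 : M) :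
  (1 < n)%N -> atlas c -> cdom c x0 ->
  exists O : set M, [/\ open O, O x0 & removable (O `&` [set x | cdom c x /\
    forall i : 'I_n, (n - 2 <= i)%N -> cfun c x ord0 i = cfun c x0 ord0 i])].
Proof.
move=> n1 ac dx0; have hc := atlas_chart ac; have [odc oc cK _ _] := hc.
have [t ht tx0] := triv_cover E x0.
pose p := cfun c x0; pose W0 := cfun c @` (cdom c `&` tdom t).
have oW0 : open W0 := chart_image_open hc (triv_open ht).
have W0p : W0 p by exists x0.
have [e0 /= e0_gt0 he0] := (nbhs_ballP _ _).1 (open_nbhs_nbhs (conj oW0 W0p)).
(* The half-width [1/L = e0/2] puts the closed [box 0] inside the ball of radius [e0]. *)
pose L := 2 / e0; have L0 : 0 < L by rewrite divr_gt0.
have scale0 i : scale L 0 i = L :> R.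
  by rewrite /scale; case: ifP; rewrite ?expr0 ?mulr1.
have bW0 : box p L 0 `<=` W0.
  move=> y yb; apply: he0; split=> // i j; rewrite (ord1 i) /ball /= distrC.
  apply: (le_lt_trans (yb j)); rewrite scale0 /L invf_div.
  by rewrite ltr_pdivrMr//; lra.
have bc : box p L 0 `<=` crange c.
  by move=> y /bW0[x [dx _] <-]; exists x.
have [C1 C10 hC1] := mu_mbox hmu n1 ac L0 bc.
have [H H0 hH] := nsq_decay ac ht L0 bW0.
pose d : R := 2 * n%:R + 1.
have d0 : 0 < d by rewrite /d; have := ler0n R n; lra.
(* On [V N] the [N]-th cutoff vanishes by [logcut_eq0]; the strict inequality makes it open. *)
pose V N := [set y : 'rV[R]_n |
  forall i, `|y ord0 i - p ord0 i| < (scale L N i * d)^-1].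
pose O N := cdom c `&` cfun c @^-1` V N.
have oO N : open (O N).
  by apply: chart_nbhs_open => //; exact: open_coordinate_box.
exists (O 0%N); split=> //.
  by split=> // i /=; rewrite subrr normr0 invr_gt0 mulr_gt0// scale_gt0.
set K := _ `&` _.
(* The last two coordinates agree with those of [x0] on [K], and the others are not rescaled, so
   their bound for [N] is the one for [0]. *)
have KO N : K `<=` O N.
  move=> x [[dx xV] [_ xK]]; split=> // i /=.
  case: (leqP (n - 2) i) => ni.
    by rewrite xK// subrr normr0 invr_gt0 mulr_gt0// scale_gt0.
  have := xV i; rewrite scale0.
  by have -> : scale L N i = L by rewrite /scale leqNgt ni.
move=> W [p1 p2] [Lp1 Lp2 h]; split=> // e e_gt0.
(* [L2distsq_le] doubles this, which leaves [e / 2] for the error of the cutoff. *)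
have e4 : 0 < e / 4 by rewrite divr_gt0.
have [_ [[u Gu <-] /= h1 h2]] := h _ e4.
have Gu' : Gamma_c E setT u by exact: Gamma_c_subset Gu.
(* [u] is fixed before [N] is chosen, so [C2] and [C3] may depend on it. *)
have [C2 C20 hC2] := commutator_bound hD ac ht (@box_compact _ _ p L 0) bW0 Gu'.
have [C3 C30 hC3] : exists2 C, 0 <= C & forall x k, mbox c p L 0 x ->
    cabs (tfun t (u x) k ord0) <= C.
  have hk k : exists C, 0 <= C /\ forall y, box p L 0 y ->
      cabs (tfun t (u (cinv c y)) k ord0) <= C.
    have [su _ _] := Gu.
    have [C C0 hC] := csmooth_bounded (@box_compact _ _ p L 0) bW0 (su t ht k c ac).
    by exists C.
  have /choice[C hC] := hk.
  exists (\sum_k C k); first by apply: sumr_ge0 => k _; exact: (hC k).1.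
  move=> x k [dx bx]; rewrite (bigD1 k)//=; apply: ler_wpDr.
    by apply: sumr_ge0 => l _; exact: (hC l).1.
  by have := (hC k).2 _ bx; rewrite cK.
pose B := logcut_bound L.
have B0 : 0 <= B by exact: logcut_bound_ge0.
(* The sum of the constants for [D (f u) - D u] and for [f u - u], so that one [N] serves both. *)
pose A := H * ((C2 * B) ^+ 2 + (C3 * B) ^+ 2).
have A0 : 0 <= A by rewrite mulr_ge0// addr_ge0// sqr_ge0.
(* [6] is the factor [2] of [L2distsq_le] times the [3] of [decay]. *)
have [N N0 hN] : exists2 N, (0 < N)%N & 6 * A * C1 / N%:R < e / 2.
  pose q := 6 * A * C1 / (e / 2).
  have q0 : 0 <= q.
    apply: divr_ge0; last by rewrite divr_ge0// ltW.
    by apply: mulr_ge0 => //; exact: mulr_ge0.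
  exists (Num.bound q).+1 => //.
  rewrite ltr_pdivrMr// -ltr_pdivrMl ?divr_gt0// mulrC.
  by apply: (lt_trans (archi_boundP q0)); rewrite ltr_nat.
pose f := mlogcut c p L N.
have sf : rsmooth f by exact: mlogcut_smooth.
have Gf : Gamma_c E (W `\` K) (mulsec f u).
  apply: (mulsec_Gamma Gu sf (oO N) _ (KO N)) => x [dx xV].
  rewrite /f mlogcut_dom//; apply: logcut_eq0 => // i.
  exact: ltW (xV i).
have Gf' : Gamma_c E setT (mulsec f u) by exact: Gamma_c_subset Gf.
have f1 x : mbox c p L 0 x -> `|1 - f x| <= B * overlap p L N (cfun c x).
  by move=> [dx bx]; rewrite /f mlogcut_dom//; exact: logcut_overlap.
have f0 x : ~ mbox c p L 0 x -> f x = 1 by exact: mlogcut_eq1.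
have tmbox x : mbox c p L 0 x -> tdom t x.
  move=> [dx bx]; have [z [dz tz] zx] := bW0 _ bx.
  by rewrite -(cK _ dx) -zx cK.
have est (v w z : section E) :
    (forall x, nsq (v x - w x) <= A * decay c p L N x) ->
    (L2distsq mu w z < (e / 4)%:E)%E -> (L2distsq mu v z < e%:E)%E.
  move=> vw wz.
  have mF : measurable_fun [set: borel M]
      ((fun x => A * decay c p L N x) : borel M -> R).
    by apply: measurable_funM => //; exact: measurable_decay.
  apply: (le_lt_trans (L2distsq_le mu z mF vw)).
  apply: (@le_lt_trans _ _ ((6 * A * C1 / N%:R)%:E + 2%:E * (e / 4)%:E)%E); last first.
    by rewrite -EFinM -EFinD lte_fin; lra.
  apply: leeD; last by apply: lee_wpmul2l => //; exact: ltW.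
  have Nn0 : N%:R != 0 :> R by rewrite pnatr_eq0 -lt0n.
  have -> : 6 * A * C1 / N%:R = 2 * A * (3 / N%:R ^+ 2) * (N%:R * C1) by field.
  have a0 : 0 <= 2 * A * (3 / N%:R ^+ 2).
    by apply: mulr_ge0; [exact: mulr_ge0|rewrite divr_ge0// exprn_ge0].
  apply: le_trans (integral_weighted_indic N (mbox_measurable hc L0 bc) a0 hC1).
  rewrite le_eqVlt; apply/orP; left; apply/eqP; apply: eq_integral => x _.
  by rewrite /decay !mulrA.
exists (mulsec f u, D (mulsec f u)); split; first by exists (mulsec f u).
- apply: (est _ u) => //= x.
  apply: (@le_trans _ _ (H * (C3 * B) ^+ 2 * decay c p L N x)); last first.
    rewrite ler_wpM2r ?decay_ge0// ler_wpM2l// lerDr; exact: sqr_ge0.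
  apply: (hH (C3 * B) N (fun x => mulsec f u x - u x)); first exact: mulr_ge0.
    move=> {}x xb; rewrite /mulsec f0//.
    have -> : Complex 1 0 = 1 :> R[i] by [].
    by rewrite scale1r subrr.
  move=> {}x k xb tx; rewrite (tfunB ht tx) /mulsec (tfunZ ht tx) !mxE.
  rewrite -[X in _ * X - X]mul1r mulrA -mulrBl mulr1.
  have -> : Complex (f x) 0 - 1 = Complex (f x - 1) 0.
    by apply/eqP; rewrite eq_complex /= oppr0 addr0 !eqxx.
  apply: (le_trans (cabsM _ _)); rewrite cabs_real mulrC -mulrA distrC.
  by apply: ler_pM; rewrite ?cabs_ge0//; [exact: hC3|exact: f1].
- apply: (est _ (D u)) => //= x.
  apply: (@le_trans _ _ (H * (C2 * B) ^+ 2 * decay c p L N x)); last first.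
    rewrite ler_wpM2r ?decay_ge0// ler_wpM2l// lerDl; exact: sqr_ge0.
  apply: (hH (C2 * B) N (fun x => D (mulsec f u) x - D u x)); first exact: mulr_ge0.
    move=> {}x xb; apply/eqP; rewrite subr_eq0; apply/eqP.
    (* Off the closed [mbox 0] the cutoff is [1], so [f u] and [u] agree on an open set. *)
    apply: (D_local hD Gf' Gu' (O := ~` mbox c p L 0)) => //.
      by apply: closed_openC; exact: mbox_closed.
    move=> z zb; rewrite /mulsec f0//.
    have -> : Complex 1 0 = 1 :> R[i] by [].
    by rewrite scale1r.
  move=> {}x k xb tx; rewrite -mulrA; have [dx bx] := xb.
  apply: (hC2 f sf Gf' x dx tx bx); first exact: f1.
  move=> i.
  have -> : 'D_(delta_mx ord0 i) (f \o cinv c) (cfun c x) =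
      'D_(delta_mx ord0 i) (logcut p L N) (cfun c x).
    apply: near_eq_derive.
    have cx : crange c (cfun c x) by exists x.
    apply: filterS (open_nbhs_nbhs (conj oc cx)) => _ [z dz <-].
    by rewrite /comp (cK _ dz) /f (mlogcut_dom _ _ _ dz).
  exact: derive_logcut_overlap.
Qed.

(** Since [k <= n - 2], the last two coordinates of a slice chart vanish on [P], so
    [slice_removable] applies near each point; compactness leaves finitely many pieces. *)
Lemma submanifold_removable (k : nat) (P : set M) : embedded_submanifold k P ->
  compact P -> (1 < n - k)%N -> removable P.
Proof.
move=> [kn hP] cP codim.
have n1 : (1 < n)%N by apply: leq_trans codim _; exact: leq_subr.
have /choice[U hU] : forall x : M, exists U : set M,
    P x -> [/\ open U, U x & removable (U `&` P)].
  (* Off [P] the empty set is a dummy value. *)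
  move=> x; have [Px|nPx] := pselect (P x); last by exists set0.
  have [c [ac dx cP']] := hP x Px; have [od _ _ _ _] := atlas_chart ac.
  have [U [oU Ux rU]] := slice_removable n1 ac dx.
  exists (U `&` cdom c) => _; split=> //; first exact: openI.
  apply: removable_subset rU => y [[Uy dy] Py]; split=> //; split=> // i ni.
  have ki : (k <= i)%N.
    by apply: leq_trans ni; rewrite leq_subRL// addnC -leq_subRL// ltnW.
  by rewrite ((cP' y dy).1 Py i ki) ((cP' x dx).1 Px i ki).
move: cP; rewrite compact_cover => /(_ _ P U).
case=> [x /hU[]//|x Px|s sP Ps]; first by exists x => //; have [] := hU x Px.
apply: (@removable_subset _
    [set x | exists2 i, i \in finmap.enum_fset s & (U i `&` P) x]).
  by move=> x Px; have [i si Oi] := Ps x Px; exists i.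
by apply: removable_bigcup => i si; have /set_mem/hU[] := sP i si.
Qed.

End Removable.

(** * Removal of the whole union and equality of the closures *)

Theorem proposition30 (R : realType) (n : nat) (M : manifold R n)
    (g : riemannian_metric M) (mu : {measure set (borel M) -> \bar R})
    (hmu : is_riemannian_measure g mu)
    (m : nat) (k : 'I_m -> nat) (P : 'I_m -> set M)
    (hP : forall j, embedded_submanifold (k j) (P j))
    (cP : forall j, compact (P j))
    (codimP : forall j, (1 < n - k j)%N)
    (r : nat) (E : hermitian_bundle M r)
    (D : section E -> section E) (hD : first_order_operator D) :
  op_closure mu (op_graph D (Gamma_c E (~` \bigcup_j P j))) =
  op_closure mu (op_graph D (Gamma_c E setT)).
Proof.
have rP : removable mu D (\bigcup_j P j).
  apply: (@removable_subset _ _ _ _ _ _ _ _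
      [set x | exists2 j, j \in enum 'I_m & P j x]).
    by move=> x [j _ Pjx]; exists j; rewrite ?mem_enum.
  apply: removable_bigcup => j _.
  by apply: (submanifold_removable hmu hD (hP j)).
apply/seteqP; split.
  by apply: op_closure_mono; apply: op_graph_mono.
by rewrite -setTD; exact: rP.
Qed.
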